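(* Let $V$ be a valuation domain with quotient field $K$, and let $U$ be a fixed extension of $V$ to an algebraic closure $\overline{K}$ of $K$, with valuation $u$. Let $\mathcal{B}_u$ be the set of balls $B_u(\alpha,\delta)=\{x\in\overline{K}:u(x-\alpha)\ge\delta\}$ with $(\alpha,\delta)\in\overline{K}\times\Gamma_{\overline{v}}$, on which $\mathcal{D}(U)$ acts by $\sigma(B_u(\alpha,\delta))=B_u(\sigma(\alpha),\delta)$, and let $\mathcal{B}_u/\mathcal{D}(U)$ be the set of orbits. Let $\mathcal{W}_{\mathrm{rt}}$ be the set of residually transcendental extensions of $V$ to $K(X)$. Then the map $\Theta:\mathcal{B}_u/\mathcal{D}(U)\to\mathcal{W}_{\mathrm{rt}}$, $[B_u(\alpha,\delta)]\mapsto U_{\alpha,\delta}\cap K(X)$, is well defined and bijective.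
   Context: $v$ is the valuation of $V$, $\Gamma_v$ its value group and $\Gamma_{\overline{v}}=\Gamma_v\otimes_{\mathbb{Z}}\mathbb{Q}$. For $(\alpha,\delta)\in\overline{K}\times\Gamma_{\overline{v}}$, the monomial valuation $u_{\alpha,\delta}$ on $\overline{K}(X)$ is defined on polynomials by $u_{\alpha,\delta}\big(\sum_{i}a_i(X-\alpha)^i\big)=\min_i\{u(a_i)+i\delta\}$ and extended to $\overline{K}(X)$; $U_{\alpha,\delta}$ is its valuation domain. $\mathcal{D}(U)=\{\sigma\in\mathrm{Gal}(\overline{K}/K):\sigma(U)=U\}$. An extension of $V$ to $K(X)$ is a valuation domain $W$ of $K(X)$ with $W\cap K=V$; it is residually transcendental if its residue field is transcendental over the residue field of $V$. *)

(* Defs.v *)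
From HB Require Import structures.
From mathcomp Require Import all_boot all_order all_algebra.
From mathcomp Require Import generic_quotient fraction.
Set Implicit Arguments.
Unset Strict Implicit.
Unset Printing Implicit Defensive.
Import Order.TTheory GRing.Theory.
Local Open Scope ring_scope.

Notation "x %:F" := (@FracField.tofrac _ x).

Definition is_valuation_domain (F : fieldType) (R : F -> Prop) : Prop :=
  [/\ R 0, R 1,
      (forall x y, R x -> R y -> R (x - y)),
      (forall x y, R x -> R y -> R (x * y)) &
      (forall x, x != 0 -> R x \/ R x^-1)].

(* The valuation u of the valuation domain U, compared through U:
   vle U a b  <->  u(a) <= u(b)   (with u(0) = +oo). *)
Definition vle (F : fieldType) (U : F -> Prop) (a b : F) : Prop :=
  b = 0 \/ (a != 0 /\ U (b / a)).

(* Ball B_u(alpha, delta) with delta = u(c), c <> 0 :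
   { x | u(x - alpha) >= u(c) }. *)
Definition ball (F : fieldType) (U : F -> Prop) (alpha c : F) : F -> Prop :=
  fun x => vle U c (x - alpha).

(* Coefficients a_i of p = sum_i a_i (X - alpha)^i. *)
Definition coefAt (F : fieldType) (alpha : F) (p : {poly F}) (i : nat) : F :=
  (p \Po ('X + alpha%:P))`_i.

(* u_{alpha,delta}(g) <= u_{alpha,delta}(f), delta = u(c), where
   u_{alpha,delta}(sum_i a_i (X-alpha)^i) = min_i (u(a_i) + i delta)
                                          = min_i u(a_i c^i). *)
Definition mono_le (F : fieldType) (U : F -> Prop) (alpha c : F)
    (g f : {poly F}) : Prop :=
  exists j : nat, forall i : nat,
    vle U (coefAt alpha g j * c ^+ j) (coefAt alpha f i * c ^+ i).

Definition monoU (F : fieldType) (U : F -> Prop) (alpha c : F)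
    : {fraction {poly F}} -> Prop :=
  fun psi => exists f g : {poly F},
    [/\ g != 0, psi = f%:F / g%:F & mono_le U alpha c g f].

Definition embedKX (K L : fieldType) (iota : {rmorphism K -> L})
    (phi : {fraction {poly K}}) : {fraction {poly L}} :=
  (map_poly iota (\n_(repr phi)))%:F / (map_poly iota (\d_(repr phi)))%:F.

Definition Theta (K L : fieldType) (iota : {rmorphism K -> L})
    (U : L -> Prop) (alpha c : L) : {fraction {poly K}} -> Prop :=
  fun phi => monoU U alpha c (embedKX iota phi).

Definition in_decomposition_group (K L : fieldType) (iota : {rmorphism K -> L})
    (U : L -> Prop) (sigma : {rmorphism L -> L}) : Prop :=
  [/\ bijective sigma,
      (forall k, sigma (iota k) = iota k) &
      (forall y, U y <-> exists2 x, U x & sigma x = y)].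

Definition same_orbit (K L : fieldType) (iota : {rmorphism K -> L})
    (U : L -> Prop) (alpha c alpha' c' : L) : Prop :=
  exists sigma : {rmorphism L -> L},
    in_decomposition_group iota U sigma /\
    (forall x, ball U (sigma alpha) c x <-> ball U alpha' c' x).

Definition constKX (K : fieldType) (k : K) : {fraction {poly K}} := (k%:P)%:F.

Definition is_extension_KX (K : fieldType) (V : K -> Prop)
    (W : {fraction {poly K}} -> Prop) : Prop :=
  is_valuation_domain W /\ (forall k, W (constKX k) <-> V k).

Definition max_ideal (F : fieldType) (R : F -> Prop) (x : F) : Prop :=
  R x /\ (x = 0 \/ ~ R x^-1).

(* Residually transcendental: the residue field of W is transcendental over the
   residue field of V (embedded via V -> W), i.e. some residue class w + m_W is
   not a root of any nonzero polynomial over k_V; a nonzero polynomial over k_V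
   is the reduction of a P in V[T] having some coefficient which is a unit of V. *)
Definition residually_transcendental (K : fieldType) (V : K -> Prop)
    (W : {fraction {poly K}} -> Prop) : Prop :=
  exists2 w, W w &
    forall P : {poly K},
      (forall i, V P`_i) ->
      (exists i, [/\ P`_i != 0, V P`_i & V (P`_i)^-1]) ->
      ~ max_ideal W (map_poly (@constKX K) P).[w].

(* Main.v *)
Require Import Defs.
From HB Require Import structures.
From mathcomp Require Import all_boot all_order all_algebra.
From mathcomp Require Import generic_quotient fraction.
From mathcomp Require Import boolp.
From mathcomp Require Import ring zify mpoly perm.
From mathcomp Require classical_sets.
Set Implicit Arguments.
Unset Strict Implicit.
Unset Printing Implicit Defensive.
Import GRing.Theory.
Local Open Scope ring_scope.

(** The substitution of [alpha + c X] for [X] turns [u_{alpha,delta}] into the Gauss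
    valuation, so all properties of monomial valuations come from the Gauss lemma.

    The main tool is the conjugacy of the extensions to [L(X)] of a valuation of [K(X)]
    under Aut (L / K), where [L] is the algebraic closure of [K].  A maximal partial
    isomorphism over [K(X)] carrying the first extension to the second is total: if [beta]
    has conjugates [r], and for every [r] some [z] is integral at [beta] but not at [r], let
    [A] be a primitive annihilator of [z] and [A(Z) = (Z - z) Q(Z)].  By the Gauss lemma [Q]
    is integral at all conjugates, primitive at [beta] and zero modulo the maximal ideal at
    [r].  The product of these [Q] has a coefficient [q] that is a unit at [beta] and in the
    maximal ideal at all conjugates, which contradicts the equation [\prod (Z - q(r)) = 0]
    satisfied by [q].

    Injectivity is conjugacy applied to two monomial valuations with the same restriction.
    For surjectivity, extend [W] to [L(X)] and conjugate its restriction to [L] into [U].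
    If no [(X - a) / c] had a residue transcendental over that of [L], then either some
    [X - b] would have a value outside the value group of [L], or for any [a_1, ..., a_n]
    some [X - b] would have a larger value than all [X - a_i]; in both cases the residue of
    every rational function of value 0 would be that of a constant. *)

(** * Valuation domains and the Gauss lemma *)

Definition vd_poly (F : fieldType) (W : F -> Prop) (f : {poly F}) :=
  forall i, W f`_i.

(** The polynomials of Gauss valuation 0. *)
Definition primitive_poly (F : fieldType) (W : F -> Prop) (f : {poly F}) :=
  vd_poly W f /\ exists i, ~ max_ideal W f`_i.

(** Comparison of two Gauss valuations without a value group: one coefficient of [g] bounds all
    coefficients of [f] from below. *)
Definition gauss_le (F : fieldType) (W : F -> Prop) (g f : {poly F}) :=
  exists j, forall i, vle W g`_j f`_i.

Section ValuationDomain.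
Variables (F : fieldType) (W : F -> Prop).
Hypothesis hW : is_valuation_domain W.
Implicit Types (x y z : F) (f g : {poly F}).

Lemma vd0 : W 0. Proof. by case: hW. Qed.
Lemma vd1 : W 1. Proof. by case: hW. Qed.
Lemma vdB x y : W x -> W y -> W (x - y). Proof. by case: hW => _ _ + _ _; apply. Qed.
Lemma vdM x y : W x -> W y -> W (x * y). Proof. by case: hW => _ _ _ + _; apply. Qed.
Lemma vdN x : W x -> W (- x).
Proof. by move=> Wx; rewrite -sub0r; apply: vdB => //; exact: vd0. Qed.
Lemma vdD x y : W x -> W y -> W (x + y).
Proof. by move=> Wx Wy; rewrite -(opprK y); apply: vdB => //; exact: vdN. Qed.
Lemma vdX x n : W x -> W (x ^+ n).
Proof.
by move=> Wx; elim: n => [|n IH]; rewrite ?expr0 ?exprS; [exact: vd1|exact: vdM].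
Qed.
Lemma vd_sum (I : Type) (r : seq I) (P : pred I) (G : I -> F) :
  (forall i, P i -> W (G i)) -> W (\sum_(i <- r | P i) G i).
Proof. by move=> h; apply: big_ind => //; [exact: vd0|exact: vdD]. Qed.

Lemma vd_or_inv x : W x \/ W x^-1.
Proof.
have [->|x0] := eqVneq x 0; first by left; exact: vd0.
by case: hW => _ _ _ _; apply.
Qed.

Lemma max_ideal0 : max_ideal W 0.
Proof. by split; [exact: vd0|left]. Qed.

Lemma max_ideal1 : ~ max_ideal W 1.
Proof. by case=> _ [/eqP|]; rewrite ?oner_eq0 // invr1 => /(_ vd1). Qed.

Lemma not_vd x : ~ W x -> [/\ x != 0, W x^-1 & max_ideal W x^-1].
Proof.
move=> nW; have x0 : x != 0 by apply: contra_notN nW => /eqP ->; exact: vd0.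
have Wi : W x^-1 by case: (vd_or_inv x).
by split=> //; split=> //; right; rewrite invrK.
Qed.

Lemma not_max_ideal x : ~ max_ideal W x -> x != 0 /\ W x^-1.
Proof.
move=> nm; have x0 : x != 0 by apply: contra_notN nm => /eqP ->; exact: max_ideal0.
split=> //; apply: contrapT => nWi; apply: nm.
by have [_] := not_vd nWi; rewrite invrK.
Qed.

Lemma max_idealP x : x != 0 -> max_ideal W x <-> ~ W x^-1.
Proof.
move=> x0; split=> [[_ []] // xe|nWi]; first by rewrite xe eqxx in x0.
by have [_] := not_vd nWi; rewrite invrK.
Qed.

Lemma max_idealM x y : W x -> max_ideal W y -> max_ideal W (x * y).
Proof.
move=> Wx my; apply: contrapT => /not_max_ideal [].
rewrite mulf_eq0 negb_or => /andP[x0 y0] Wi.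
case/(max_idealP y0): my.
have -> : y^-1 = x * (x * y)^-1 by rewrite invfM mulrA divff ?mul1r.
exact: vdM.
Qed.

Lemma max_idealMr x y : W x -> max_ideal W y -> max_ideal W (y * x).
Proof. by rewrite mulrC; exact: max_idealM. Qed.

Lemma max_idealD x y : max_ideal W x -> max_ideal W y -> max_ideal W (x + y).
Proof.
have [->|x0] := eqVneq x 0; first by rewrite add0r.
have [->|y0] := eqVneq y 0; first by rewrite addr0.
move=> mx my; case: (vd_or_inv (x / y)) => h.
  have -> : x + y = (x / y + 1) * y by rewrite mulrDl divfK // mul1r.
  by apply: max_idealM => //; apply: vdD => //; exact: vd1.
have -> : x + y = (y / x + 1) * x by rewrite mulrDl divfK // mul1r addrC.
by apply: max_idealM => //; apply: vdD; [rewrite -invf_div|exact: vd1].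
Qed.

Lemma max_idealN x : max_ideal W x -> max_ideal W (- x).
Proof. by rewrite -mulN1r; apply: max_idealM; apply: vdN; exact: vd1. Qed.

Lemma max_idealB x y : max_ideal W x -> max_ideal W y -> max_ideal W (x - y).
Proof. by move=> mx my; apply: max_idealD => //; exact: max_idealN. Qed.

Lemma max_ideal_sum (I : Type) (r : seq I) (P : pred I) (G : I -> F) :
  (forall i, P i -> max_ideal W (G i)) -> max_ideal W (\sum_(i <- r | P i) G i).
Proof. by move=> h; apply: big_ind => //; [exact: max_ideal0|exact: max_idealD]. Qed.

Lemma max_ideal_prime x y :
  ~ max_ideal W x -> ~ max_ideal W y -> ~ max_ideal W (x * y).
Proof.
move=> /not_max_ideal[x0 Wx] /not_max_ideal[y0 Wy].
by rewrite max_idealP ?mulf_neq0 // invfM; apply; exact: vdM.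
Qed.

Lemma max_ideal_exp x n : ~ max_ideal W x -> ~ max_ideal W (x ^+ n).
Proof.
move=> nx; elim: n => [|n IH]; rewrite ?expr0 ?exprS; first exact: max_ideal1.
exact: max_ideal_prime.
Qed.

Lemma max_idealX x n : (0 < n)%N -> max_ideal W x -> max_ideal W (x ^+ n).
Proof. by case: n => // n _ mx; rewrite exprSr; apply: max_idealM => //; apply: vdX; case: mx. Qed.

Lemma unit_addr x y : ~ max_ideal W x -> max_ideal W y -> ~ max_ideal W (x + y).
Proof. by move=> nx my mxy; apply: nx; rewrite -(addrK y x); exact: max_idealB. Qed.

Lemma vle_refl x : vle W x x.
Proof.
have [->|x0] := eqVneq x 0; first by left.
by right; split=> //; rewrite divff //; exact: vd1.
Qed.

Lemma vle0 x : vle W x 0. Proof. by left. Qed.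

Lemma vle_eq0 x : vle W 0 x -> x = 0.
Proof. by case=> // -[]; rewrite eqxx. Qed.

Lemma vle_trans y x z : vle W x y -> vle W y z -> vle W x z.
Proof.
move=> [-> /vle_eq0 ->|[x0 Wyx]]; first exact: vle0.
case=> [->|[y0 Wzy]]; first exact: vle0.
right; split=> //; have -> : z / x = (z / y) * (y / x) by rewrite mulrA divfK.
exact: vdM.
Qed.

Lemma vle_total x y : vle W x y \/ vle W y x.
Proof.
have [->|x0] := eqVneq x 0; first by right; exact: vle0.
have [->|y0] := eqVneq y 0; first by left; exact: vle0.
by case: (vd_or_inv (x / y)); rewrite ?invf_div => h; [right|left]; right.
Qed.

Lemma vleP x y : x != 0 -> vle W x y <-> W (y / x).
Proof.
move=> x0; split=> [[->|[]]//|]; first by rewrite mul0r; exact: vd0.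
by right.
Qed.

Lemma vle_mul x y x' y' : vle W x y -> vle W x' y' -> vle W (x * x') (y * y').
Proof.
move=> [->|[x0 h]]; first by rewrite mul0r => _; exact: vle0.
move=> [->|[y0 h']]; first by rewrite mulr0; exact: vle0.
by apply/vleP; rewrite ?mulf_neq0 // -mulf_div; exact: vdM.
Qed.

Lemma vle1P x : vle W 1 x <-> W x.
Proof. by rewrite vleP ?oner_eq0 // divr1. Qed.

Lemma vleD z x y : vle W z x -> vle W z y -> vle W z (x + y).
Proof.
have [->|z0] := eqVneq z 0; first by move=> /vle_eq0 -> /vle_eq0 ->; rewrite addr0; exact: vle0.
by rewrite !vleP // mulrDl; exact: vdD.
Qed.

Lemma vleMr z x y : W y -> vle W z x -> vle W z (y * x).
Proof.
move=> Wy h; have := vle_mul (proj2 (vle1P y) Wy) h.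
by rewrite mul1r.
Qed.

Lemma vleN z x : vle W z x -> vle W z (- x).
Proof. by move=> h; rewrite -mulN1r; apply: vleMr => //; apply: vdN; exact: vd1. Qed.

Lemma vleB z x y : vle W z x -> vle W z y -> vle W z (x - y).
Proof. by move=> h h'; apply: vleD => //; exact: vleN. Qed.

Lemma not_vle x y : y != 0 -> ~ vle W x y -> max_ideal W (x / y).
Proof.
move=> y0 nle; have [->|x0] := eqVneq x 0; first by rewrite mul0r; exact: max_ideal0.
apply/max_idealP; first by rewrite mulf_neq0 ?invr_eq0.
by rewrite invf_div => h; apply: nle; apply/vleP.
Qed.

Lemma vle_min_seq (s : seq F) : s != [::] ->
  exists2 x, x \in s & forall y, y \in s -> vle W x y.
Proof.
elim: s => // a s IH _; have [->|s0] := eqVneq s [::].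
  by exists a; rewrite ?mem_head // => y; rewrite inE => /eqP ->; exact: vle_refl.
have [x xs xmin] := IH s0; case: (vle_total a x) => h.
  exists a; rewrite ?mem_head // => y; rewrite inE => /orP[/eqP ->|ys]; first exact: vle_refl.
  exact: vle_trans (xmin _ ys).
exists x; first by rewrite inE xs orbT.
by move=> y; rewrite inE => /orP[/eqP -> //|]; exact: xmin.
Qed.

Lemma content_ex f : f != 0 ->
  exists2 j, f`_j != 0 & forall i, vle W f`_j f`_i.
Proof.
move=> f0; have [|x xf xmin] := @vle_min_seq (polyseq f).
  by apply: contraNneq f0 => fe; rewrite -size_poly_eq0 fe.
have [j jlt ej] := nthP 0 xf; rewrite -{x}ej in xf xmin.
have le i : vle W f`_j f`_i.
  have [h|h] := ltnP i (size f); first by apply: xmin; exact: mem_nth.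
  by rewrite (nth_default _ h); exact: vle0.
exists j => //; apply: contraNneq f0 => fj0; apply/eqP/polyP => i.
by rewrite coef0; apply: vle_eq0; have := le i; rewrite fj0.
Qed.

Lemma primitive_part f : f != 0 ->
  exists a f0, [/\ a != 0, f = a *: f0 & primitive_poly W f0].
Proof.
move=> f0; have [j fj0 le] := content_ex f0.
exists f`_j, ((f`_j)^-1 *: f); split => //; first by rewrite scalerA divff ?scale1r.
split=> [i|]; first by rewrite coefZ mulrC; apply/vleP.
by exists j; rewrite coefZ mulVf //; exact: max_ideal1.
Qed.

Lemma primitive_neq0 f : primitive_poly W f -> f != 0.
Proof.
case=> _ [i ni]; apply: contra_notN ni => /eqP ->.
by rewrite coef0; exact: max_ideal0.
Qed.

Lemma vd_polyM f g : vd_poly W f -> vd_poly W g -> vd_poly W (f * g).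
Proof. by move=> hf hg i; rewrite coefM; apply: vd_sum => k _; exact: vdM. Qed.

Lemma vd_polyB f g : vd_poly W f -> vd_poly W g -> vd_poly W (f - g).
Proof. by move=> hf hg i; rewrite coefB; exact: vdB. Qed.

Lemma vd_polyZ a f : W a -> vd_poly W f -> vd_poly W (a *: f).
Proof. by move=> Wa hf i; rewrite coefZ; exact: vdM. Qed.

Lemma primitive_lowest f : primitive_poly W f ->
  exists2 i, ~ max_ideal W f`_i & forall k, (k < i)%N -> max_ideal W f`_k.
Proof.
case=> _ [i0 hi0].
have ex : exists i, `[< ~ max_ideal W f`_i >] by exists i0; apply/asboolP.
case: (ex_minnP ex) => i /asboolP hi imin; exists i => // k ki.
apply: contrapT => nk; have /imin : `[< ~ max_ideal W f`_k >] by apply/asboolP.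
by rewrite leqNgt ki.
Qed.

(** Gauss's lemma: if [i] and [j] are the lowest indices of unit coefficients, the coefficient of
    index [i + j] of the product is a unit plus terms of the maximal ideal. *)
Lemma primitiveM f g : primitive_poly W f -> primitive_poly W g -> primitive_poly W (f * g).
Proof.
move=> pf pg; split; first by apply: vd_polyM; [case: pf|case: pg].
have [i ni hi] := primitive_lowest pf; have [j nj hj] := primitive_lowest pg.
exists (i + j)%N; rewrite coefM.
have ilt : (i < (i + j).+1)%N by rewrite ltnS leq_addr.
rewrite (bigD1 (Ordinal ilt)) //= addKn; apply: unit_addr; first exact: max_ideal_prime.
apply: max_ideal_sum => -[k klt] /= kne.
have [ki|ik] := ltnP k i; first by apply: max_idealMr; [case: pg|exact: hi].
apply: max_idealM; first by case: pf.
have ki : k <> i by move=> ki; move/negP: kne; apply; apply/eqP/val_inj.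
by apply: hj; lia.
Qed.

Lemma primitive1 : primitive_poly W 1.
Proof.
split=> [i|]; first by rewrite coef1; case: eqP => _; [exact: vd1|exact: vd0].
by exists 0%N; rewrite coef1; exact: max_ideal1.
Qed.

Lemma primitive_prod (I : eqType) (r : seq I) (G : I -> {poly F}) :
  (forall i, i \in r -> primitive_poly W (G i)) -> primitive_poly W (\prod_(i <- r) G i).
Proof.
move=> h; rewrite big_seq; elim/big_rec: _ => [|i f ir hf]; first exact: primitive1.
by apply: primitiveM => //; exact: h.
Qed.

Lemma primitiveX f n : primitive_poly W f -> primitive_poly W (f ^+ n).
Proof.
move=> hf; elim: n => [|n IH]; rewrite ?expr0 ?exprS; first exact: primitive1.
exact: primitiveM.
Qed.

Lemma primitive_integralZ a f : primitive_poly W f -> vd_poly W (a *: f) <-> W a.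
Proof.
move=> [hf [i ni]]; split=> [/(_ i)|Wa]; last exact: vd_polyZ.
rewrite coefZ => h; have [fi0 Wi] := not_max_ideal ni.
by rewrite -(mulfK fi0 a); exact: vdM.
Qed.

Lemma integral_vle a f : a != 0 -> (forall i, vle W a f`_i) <-> vd_poly W (a^-1 *: f).
Proof.
by move=> a0; split=> h i; move: (h i); rewrite coefZ mulrC vleP.
Qed.

(** A primitive factor has Gauss valuation 0, so only the content [a] of the left side counts. *)
Lemma gauss_leE a g0 f : a != 0 -> primitive_poly W g0 ->
  gauss_le W (a *: g0) f <-> vd_poly W (a^-1 *: f).
Proof.
move=> a0 [ig [j nj]]; have [gj0 Wj] := not_max_ideal nj.
rewrite -integral_vle //; split=> [[k hk] i|h].
  apply: vle_trans (hk i); rewrite coefZ -{1}[a]mulr1; apply: vle_mul; first exact: vle_refl.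
  exact/vle1P.
exists j => i; apply: vle_trans (h i); apply/vleP; rewrite coefZ ?mulf_neq0 //.
by rewrite invfM mulrA divff // mul1r.
Qed.

Lemma gauss_le_prim a g0 b f0 : a != 0 -> primitive_poly W g0 -> primitive_poly W f0 ->
  gauss_le W (a *: g0) (b *: f0) <-> W (b / a).
Proof. by move=> a0 hg hf; rewrite gauss_leE // scalerA mulrC primitive_integralZ. Qed.

Lemma gauss_le_0 f : gauss_le W f 0.
Proof. by exists 0%N => i; rewrite coef0; exact: vle0. Qed.

(** Makes the Gauss valuation well defined on fractions: by Gauss's lemma both sides of the equation
    are a scalar times a primitive polynomial, so the two scalars differ by a unit. *)
Lemma gauss_le_cross f g f' g' : g != 0 -> g' != 0 -> f * g' = f' * g ->
  gauss_le W g f -> gauss_le W g' f'.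
Proof.
move=> g0 g'0; have [/eqP|f0] := eqVneq f 0.
  move=> /eqP -> /esym /eqP; rewrite mul0r mulf_eq0 (negPf g0) orbF => /eqP -> _.
  exact: gauss_le_0.
move=> e; have f'0 : f' != 0.
  by apply: contraNneq (mulf_neq0 f0 g'0) => f'0; rewrite e f'0 mul0r.
have [a [F0 [a0 ef pF]]] := primitive_part f0.
have [a' [F0' [a'0 ef' pF']]] := primitive_part f'0.
have [b [G0 [b0 eg pG]]] := primitive_part g0.
have [b' [G0' [b'0 eg' pG']]] := primitive_part g'0.
subst f f' g g'.
rewrite !gauss_le_prim // => Wab.
have {}e : (a * b') *: (F0 * G0') = (a' * b) *: (F0' * G0).
  by move: e; rewrite -!scalerAl -!scalerAr !scalerA.
have : vd_poly W (((a' * b)^-1 * (a * b')) *: (F0 * G0')).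
  by rewrite -scalerA e scalerA mulVf ?mulf_neq0 // scale1r; case: (primitiveM pF' pG).
have : vd_poly W (((a * b')^-1 * (a' * b)) *: (F0' * G0)).
  by rewrite -scalerA -e scalerA mulVf ?mulf_neq0 // scale1r; case: (primitiveM pF pG').
rewrite !primitive_integralZ; try exact: primitiveM.
move=> h _; have -> : a' / b' = (a * b')^-1 * (a' * b) * (a / b).
  by field; rewrite a0 b0 b'0.
exact: vdM.
Qed.

End ValuationDomain.

Lemma vd_pullback (F0 F : fieldType) (h : {rmorphism F0 -> F}) (W : F -> Prop) :
  is_valuation_domain W -> is_valuation_domain (fun x => W (h x)).
Proof.
move=> hW; split; rewrite ?rmorph0 ?rmorph1; try exact: vd0; try exact: vd1.
- by move=> x y; rewrite rmorphB; exact: vdB.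
- by move=> x y; rewrite rmorphM; exact: vdM.
by move=> x x0; rewrite fmorphV; exact: vd_or_inv.
Qed.

Lemma max_ideal_pullback (F0 F : fieldType) (h : {rmorphism F0 -> F}) (W0 : F0 -> Prop)
    (W : F -> Prop) :
  is_valuation_domain W0 -> is_valuation_domain W -> (forall x, W (h x) <-> W0 x) ->
  forall x, max_ideal W (h x) <-> max_ideal W0 x.
Proof.
move=> hW0 hW hh x; have [->|x0] := eqVneq x 0.
  by rewrite rmorph0; split=> _; exact: max_ideal0.
by rewrite !max_idealP ?fmorph_eq0 // -fmorphV hh.
Qed.

(** * Monomial valuations on rational functions *)

Lemma fraction_repr (R : idomainType) (x : {fraction R}) :
  x = (\n_(repr x))%:F / (\d_(repr x))%:F.
Proof.
set r := repr x; have d0 : \d_r != 0 by exact: denom_ratioP.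
have d0F : (\d_r)%:F != 0 :> {fraction R} by rewrite tofrac_eq0.
apply: (mulIf d0F); rewrite divfK //.
rewrite -[x]reprK -/r; unlock FracField.tofrac; rewrite -[LHS]FracField.pi_mul.
apply/eqmodP; rewrite /= FracField.equivfE /FracField.mulf.
by rewrite !numden_Ratio ?mulf_neq0 ?oner_neq0 // !mulr1 mulrC.
Qed.

Lemma fraction_ex (R : idomainType) (x : {fraction R}) :
  exists f g, g != 0 /\ x = f%:F / g%:F.
Proof.
by exists \n_(repr x), \d_(repr x); split; [exact: denom_ratioP|exact: fraction_repr].
Qed.

Lemma fraction_eq (R : idomainType) (f g f' g' : R) : g != 0 -> g' != 0 ->
  f%:F / g%:F = f'%:F / g'%:F -> f * g' = f' * g.
Proof.
move=> g0 g'0 /eqP; rewrite eqr_div ?tofrac_eq0 // -!tofracM tofrac_eq.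
by move=> /eqP.
Qed.

Section EmbedKX.
Variables (K L : fieldType) (iota : {rmorphism K -> L}).

(** [embedKX] is defined through a chosen representative; cross multiplication frees it from the
    choice, and hence makes it a ring morphism. *)
Lemma embedKX_frac (f g : {poly K}) : g != 0 ->
  embedKX iota (f%:F / g%:F) = (map_poly iota f)%:F / (map_poly iota g)%:F.
Proof.
move=> g0; rewrite /embedKX; set phi := f%:F / g%:F.
have d0 : \d_(repr phi) != 0 by exact: denom_ratioP.
have /(fraction_eq d0 g0) e := esym (fraction_repr phi).
apply/eqP; rewrite eqr_div ?tofrac_eq0 ?map_poly_eq0 // -!tofracM -!rmorphM /=.
by rewrite e.
Qed.

Lemma embedKX_is_zmod_morphism : zmod_morphism (embedKX iota).
Proof.
move=> x y; have [f [g [g0 ->]]] := fraction_ex x.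
have [f' [g' [g'0 ->]]] := fraction_ex y.
rewrite -mulNr addf_div ?tofrac_eq0 // -tofracN -!tofracM -tofracD.
rewrite !embedKX_frac ?mulf_neq0 //.
rewrite -mulNr addf_div ?tofrac_eq0 ?map_poly_eq0 // -tofracN -!tofracM -tofracD.
by rewrite rmorphD !rmorphM /= rmorphN.
Qed.

Lemma embedKX_is_monoid_morphism : monoid_morphism (embedKX iota).
Proof.
split=> [|x y].
  have {1}-> : 1 = 1%:F / 1%:F :> {fraction {poly K}} by rewrite rmorph1 divr1.
  by rewrite embedKX_frac ?oner_neq0 // !rmorph1 divr1.
have [f [g [g0 ->]]] := fraction_ex x; have [f' [g' [g'0 ->]]] := fraction_ex y.
rewrite mulf_div -!tofracM !embedKX_frac ?mulf_neq0 // mulf_div -!tofracM.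
by rewrite !rmorphM.
Qed.

HB.instance Definition _ := GRing.isZmodMorphism.Build _ _ (embedKX iota)
  embedKX_is_zmod_morphism.
HB.instance Definition _ := GRing.isMonoidMorphism.Build _ _ (embedKX iota)
  embedKX_is_monoid_morphism.

Lemma embedKX_poly (f : {poly K}) : embedKX iota f%:F = (map_poly iota f)%:F.
Proof.
by have := embedKX_frac f (oner_neq0 _); rewrite !rmorph1 !divr1.
Qed.

End EmbedKX.

Definition affine_subst (F : fieldType) (alpha c : F) (f : {poly F}) : {poly F} :=
  f \Po (c *: 'X + alpha%:P).

Section AffineSubst.
Variables (F : fieldType).
Implicit Types (alpha c : F) (f g : {poly F}).

Lemma affine_substM alpha c f g :
  affine_subst alpha c (f * g) = affine_subst alpha c f * affine_subst alpha c g.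
Proof. exact: comp_polyM. Qed.

Lemma affine_substB alpha c f g :
  affine_subst alpha c (f - g) = affine_subst alpha c f - affine_subst alpha c g.
Proof. exact: comp_polyB. Qed.

Lemma affine_substC alpha c a : affine_subst alpha c a%:P = a%:P.
Proof. exact: comp_polyC. Qed.

Lemma size_affine alpha c : c != 0 -> size (c *: 'X + alpha%:P) = 2%N.
Proof.
move=> c0; rewrite size_polyDl size_scale ?size_polyX //.
by rewrite ltnS size_polyC leq_b1.
Qed.

Lemma affine_subst_eq0 alpha c f : c != 0 -> (affine_subst alpha c f == 0) = (f == 0).
Proof. by move=> c0; rewrite comp_poly2_eq0 // size_affine. Qed.

(** The substitution is X -> X + alpha followed by X -> c X, and the latter multiplies the
    coefficient of index [i] by [c ^+ i]. *)
Lemma coefAt_affine_subst alpha c f i :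
  coefAt alpha f i * c ^+ i = (affine_subst alpha c f)`_i.
Proof.
rewrite /coefAt /affine_subst.
have -> : c *: 'X + alpha%:P = ('X + alpha%:P) \Po (c *: 'X).
  by rewrite comp_polyD comp_polyX comp_polyC.
rewrite comp_polyA; set q := f \Po _.
have e (r : {poly F}) : r \Po (c *: 'X) = \poly_(k < size r) (r`_k * c ^+ k).
  rewrite comp_polyE poly_def; apply: eq_bigr => k _.
  by rewrite exprZn scalerA.
rewrite e coef_poly; case: ltnP => // h.
by rewrite nth_default ?mul0r.
Qed.

Lemma mono_le_gauss (U : F -> Prop) alpha c g f :
  mono_le U alpha c g f <->
  gauss_le U (affine_subst alpha c g) (affine_subst alpha c f).
Proof.
split=> -[j h]; exists j => i; have := h i.
  by rewrite !coefAt_affine_subst.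
by rewrite !coefAt_affine_subst.
Qed.

End AffineSubst.

Section MonomialValuation.
Variables (F : fieldType) (U : F -> Prop).
Hypothesis hU : is_valuation_domain U.
Variables (alpha c : F).
Hypothesis c0 : c != 0.

Lemma gauss_le1C (a : F) : gauss_le U 1 a%:P <-> U a.
Proof.
have {1}-> : 1 = 1 *: 1 :> {poly F} by rewrite scale1r.
have -> : a%:P = a *: 1 by rewrite alg_polyC.
by rewrite gauss_le_prim ?oner_neq0 ?divr1 //; exact: primitive1.
Qed.

(** [monoU] asks for some representation of the fraction; by [gauss_le_cross] every representation
    gives the same answer. *)
Lemma monoU_frac (f g : {poly F}) : g != 0 ->
  monoU U alpha c (f%:F / g%:F) <-> mono_le U alpha c g f.
Proof.
move=> g0; split=> [[f' [g' [g'0 e]]]|h]; last by exists f, g.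
rewrite !mono_le_gauss; have e' := fraction_eq g0 g'0 e.
apply: (@gauss_le_cross _ _ hU); rewrite ?affine_subst_eq0 //.
by rewrite -!affine_substM e'.
Qed.

Lemma affine_primitive_part (g : {poly F}) : g != 0 ->
  exists b G0, [/\ b != 0, affine_subst alpha c g = b *: G0 & primitive_poly U G0].
Proof. by move=> g0; apply: primitive_part; rewrite ?affine_subst_eq0. Qed.

Lemma monoU_valuation_domain : is_valuation_domain (monoU U alpha c).
Proof.
have one : monoU U alpha c 1.
  have -> : 1 = 1%:F / 1%:F :> {fraction {poly F}} by rewrite rmorph1 divr1.
  apply/monoU_frac; first by rewrite oner_neq0.
  rewrite mono_le_gauss (affine_substC _ _ 1).
  by apply/gauss_le1C; exact: (vd1 hU).
split=> // [|x y|x y|x x0].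
- have -> : 0 = 0%:F / 1%:F :> {fraction {poly F}} by rewrite rmorph0 mul0r.
  apply/monoU_frac; first by rewrite oner_neq0.
  rewrite mono_le_gauss (affine_substC _ _ 0); exact: gauss_le_0.
- have [f [g [g0 ->]]] := fraction_ex x; have [f' [g' [g'0 ->]]] := fraction_ex y.
  rewrite -mulNr addf_div ?tofrac_eq0 // -tofracN -!tofracM -tofracD.
  rewrite !monoU_frac ?mulf_neq0 // !mono_le_gauss mulNr affine_substB !affine_substM.
  (* The denominators become [b *: G0] and [b' *: G0'] with primitive cofactors. The common
     denominator has content [b * b'], and divided by it the numerator is a combination of integral
     polynomials. *)
  have [b [G0 [b0 -> pG]]] := affine_primitive_part g0.
  have [b' [G0' [b'0 -> pG']]] := affine_primitive_part g'0.
  rewrite -scalerAl -!scalerAr scalerA !gauss_leE ?mulf_neq0 //; last exact: primitiveM.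
  move=> h h'; set A := affine_subst _ _ f in h *; set B := affine_subst _ _ f' in h' *.
  have -> : (b * b')^-1 *: (b' *: (A * G0') - b *: (B * G0)) =
     (b^-1 *: A) * G0' - (b'^-1 *: B) * G0.
    rewrite scalerBr !scalerA -!scalerAl; congr (_ *: _ - _ *: _).
      by field; rewrite b0 b'0.
    by field; rewrite b0 b'0.
  case: pG pG' => [iG _] [iG' _].
  by apply: vd_polyB => //; apply: vd_polyM.
- have [f [g [g0 ->]]] := fraction_ex x; have [f' [g' [g'0 ->]]] := fraction_ex y.
  rewrite mulf_div -!tofracM !monoU_frac ?mulf_neq0 // !mono_le_gauss !affine_substM.
  have [b [G0 [b0 -> pG]]] := affine_primitive_part g0.
  have [b' [G0' [b'0 -> pG']]] := affine_primitive_part g'0.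
  rewrite -scalerAl -!scalerAr scalerA !gauss_leE ?mulf_neq0 //; last exact: primitiveM.
  move=> h h'; set A := affine_subst _ _ f in h *; set B := affine_subst _ _ f' in h' *.
  have -> : (b * b')^-1 *: (A * B) = (b^-1 *: A) * (b'^-1 *: B).
    by rewrite -scalerAl -scalerAr scalerA invfM.
  exact: vd_polyM.
have [f [g [g0 e]]] := fraction_ex x; rewrite e invf_div.
have f0 : f != 0 by apply: contraNneq x0 => f0; rewrite e f0 tofrac0 mul0r.
rewrite !monoU_frac // !mono_le_gauss.
have [b [G0 [b0 -> pG]]] := affine_primitive_part g0.
have [a [F0 [a0 -> pF]]] := affine_primitive_part f0.
rewrite !gauss_le_prim //; have := vd_or_inv hU (a / b).
by rewrite invf_div.
Qed.

Lemma monoU_const (a : F) : monoU U alpha c (a%:P)%:F <-> U a.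
Proof.
have -> : (a%:P)%:F = (a%:P)%:F / 1%:F :> {fraction {poly F}} by rewrite rmorph1 divr1.
rewrite monoU_frac ?oner_neq0 // mono_le_gauss.
by rewrite (affine_substC _ _ 1) affine_substC gauss_le1C.
Qed.

End MonomialValuation.

Lemma Theta_frac (K L : fieldType) (iota : {rmorphism K -> L}) (U : L -> Prop)
    (alpha c : L) (f g : {poly K}) :
  is_valuation_domain U -> c != 0 -> g != 0 ->
  Theta iota U alpha c (f%:F / g%:F) <->
  mono_le U alpha c (map_poly iota g) (map_poly iota f).
Proof.
by move=> hU c0 g0; rewrite /Theta embedKX_frac // monoU_frac // map_poly_eq0.
Qed.

(** * Extension of valuation domains *)

Lemma zorn_chain_union (T : Type) (good : (T -> Prop) -> Prop) :
  (exists A, good A) ->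
  (forall C : (T -> Prop) -> Prop, (exists A, C A) -> (forall A, C A -> good A) ->
    (forall A B, C A -> C B -> (forall t, A t -> B t) \/ (forall t, B t -> A t)) ->
    good (fun t => exists2 A, C A & A t)) ->
  exists2 A, good A & forall B, good B -> (forall t, A t -> B t) -> forall t, B t -> A t.
Proof.
move=> [A0 gA0] hchain.
pose P (A : classical_sets.set T) := A = classical_sets.set0 \/ good A.
have [|A [PA maxA]] := @classical_sets.Zorn_bigcup T P.
- move=> C CP Ctot.
  have [[A [CA gA]]|none] := pselect (exists A, C A /\ A <> classical_sets.set0); last first.
    left; apply/funext => t; apply/propext; split=> // -[A CA At].
    by case: none; exists A; split=> // A0e; rewrite A0e in At.
  right; pose C' B := C B /\ B <> classical_sets.set0.
  have := hchain C' (ex_intro _ A (conj CA gA)) _ _.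
  have e : (fun t => exists2 B, C' B & B t) = classical_sets.bigcup C id.
    apply/funext => t; apply/propext; split=> -[B]; first by move=> [CB _] Bt; exists B.
    by move=> CB Bt; exists B => //; split=> // B0; rewrite B0 in Bt.
  rewrite e; apply; first by move=> B [CB nB]; case: (CP _ CB).
  by move=> B D [CB _] [CD _]; exact: Ctot.
case: PA => [A0e|gA]; last first.
  exists A => // B gB AB; apply: contrapT => nBA.
  by apply: (maxA B); [split|right].
(* If the empty set is maximal, every good set is empty and [A0] is already maximal. *)
exists A0 => // B gB _ t Bt; apply: contrapT => _; apply: (maxA B); last by right.
by rewrite A0e; split=> // /(_ t Bt).
Qed.

Section Chevalley.
Variables (F0 F : fieldType) (j : {rmorphism F0 -> F}) (W : F0 -> Prop).
Hypothesis hW : is_valuation_domain W.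

Let lies_over (A : F -> Prop) :=
  [/\ A 1, (forall x y, A x -> A y -> A (x - y)),
     (forall x y, A x -> A y -> A (x * y)) & forall x, A (j x) <-> W x].

Variable (A : F -> Prop).
Hypotheses (hA : lies_over A)
  (maxA : forall B, lies_over B -> (forall t, A t -> B t) -> forall t, B t -> A t).

(** The extension to [A] of the maximal ideal of [W]. One product suffices instead of a sum, since
    of two elements of a valuation domain one divides the other. *)
Let I (x : F) := exists m a, [/\ max_ideal W m, A a & x = j m * a].

Let A1 : A 1. Proof. by case: hA. Qed.
Let AB x y : A x -> A y -> A (x - y). Proof. by case: hA => _ + _ _; apply. Qed.
Let AM x y : A x -> A y -> A (x * y). Proof. by case: hA => _ _ + _; apply. Qed.
Let Aj x : A (j x) <-> W x. Proof. by case: hA. Qed.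
Let A0 : A 0. Proof. by rewrite -(subrr 1); exact: AB. Qed.
Let AN x : A x -> A (- x). Proof. by move=> Ax; rewrite -sub0r; exact: AB. Qed.
Let AD x y : A x -> A y -> A (x + y).
Proof. by move=> Ax Ay; rewrite -(opprK y); apply: AB => //; exact: AN. Qed.
Let AX x n : A x -> A (x ^+ n).
Proof. by move=> Ax; elim: n => [|n IH]; rewrite ?expr0 ?exprS //; exact: AM. Qed.
Let A_sum (J : Type) (r : seq J) (P : pred J) (G : J -> F) :
  (forall i, P i -> A (G i)) -> A (\sum_(i <- r | P i) G i).
Proof. by move=> h; apply: big_ind => //; exact: AD. Qed.

Let I0 : I 0.
Proof. by exists 0, 0; split=> //; [exact: max_ideal0|rewrite mulr0]. Qed.

Let IA x : I x -> A x.
Proof. by move=> [m [a [mm Aa ->]]]; apply: AM => //; apply/Aj; case: mm. Qed.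

Let ID x y : I x -> I y -> I (x + y).
Proof.
move=> [m [a [mm Aa ->]]] [n [b [mn Ab ->]]].
have [->|m0] := eqVneq m 0; first by rewrite rmorph0 mul0r add0r; exists n, b.
have [->|n0] := eqVneq n 0; first by rewrite rmorph0 mul0r addr0; exists m, a.
case: (vd_or_inv hW (m / n)); rewrite ?invf_div => h.
  exists n, (j (m / n) * a + b); split=> //; first by apply: AD => //; apply: AM => //; exact/Aj.
  by rewrite mulrDr mulrA -rmorphM mulrCA divff // mulr1.
exists m, (a + j (n / m) * b); split=> //; first by apply: AD => //; apply: AM => //; exact/Aj.
by rewrite mulrDr [in RHS]mulrA -rmorphM mulrCA divff // mulr1.
Qed.

Let IM x y : A x -> I y -> I (x * y).
Proof. by move=> Ax [m [a [mm Aa ->]]]; exists m, (x * a); rewrite mulrCA; split=> //; exact: AM. Qed.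

Let I_sum (J : Type) (r : seq J) (P : pred J) (G : J -> F) :
  (forall i, P i -> I (G i)) -> I (\sum_(i <- r | P i) G i).
Proof. by move=> h; apply: big_ind => //; exact: ID. Qed.

Let I1 : ~ I 1.
Proof.
move=> [m [a [mm Aa e]]]; have m0 : m != 0.
  by apply/eqP => m0; move/eqP: e; rewrite m0 rmorph0 mul0r oner_eq0.
have jm0 : j m != 0 by rewrite fmorph_eq0.
have ea : a = j m^-1 by apply: (mulfI jm0); rewrite -e -rmorphM divff // rmorph1.
by move: Aa; rewrite ea Aj; exact/max_idealP.
Qed.

(** By maximality A[x] contains some y = P(x) of F0 outside [W]. Then 1/y lies in the maximal ideal
    of [W], and P / y has its coefficients in [I] and the value 1 at x. *)
Let adjoin x : ~ A x -> exists2 Q : {poly F}, (forall i, I Q`_i) & Q.[x] = 1.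
Proof.
move=> nAx; pose B y := exists2 P : {poly F}, (forall i, A P`_i) & y = P.[x].
have AsubB t : A t -> B t.
  move=> At; exists t%:P; last by rewrite hornerC.
  by move=> i; rewrite coefC; case: eqP.
apply: contrapT => none.
have gB : lies_over B.
  split=> [|_ _ [P hP ->] [Q hQ ->]|_ _ [P hP ->] [Q hQ ->]|y]; first exact: AsubB.
  - by exists (P - Q); [move=> i; rewrite coefB; exact: AB|rewrite hornerD hornerN].
  - exists (P * Q); last by rewrite hornerM.
    by move=> i; rewrite coefM; apply: A_sum => k _; exact: AM.
  split=> [[P hP e]|Wy]; last by apply: AsubB; exact/Aj.
  apply: contrapT => nWy; case: none.
  have [y0 _ my] := not_vd hW nWy.
  exists (j y^-1 *: P); first by move=> i; rewrite coefZ; exists y^-1, P`_i; split.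
  by rewrite hornerZ -e -rmorphM mulVf // rmorph1.
apply: nAx; apply: (maxA gB AsubB); exists 'X; last by rewrite hornerX.
by move=> i; rewrite coefX; case: eqP.
Qed.

(** If the inverse of s = 1 - a were not in [A], [adjoin] would give Q(1/s) = 1 with coefficients in
    [I]. Multiplied by a power of s, this puts that power into [I], although it is 1 modulo [I]. *)
Let unitI a : I a -> 1 - a != 0 /\ A (1 - a)^-1.
Proof.
move=> Ia; set s := 1 - a.
have s0 : s != 0 by apply/eqP => /eqP; rewrite subr_eq0 => /eqP e; apply: I1; rewrite e.
split=> //; apply: contrapT => /adjoin[Q IQ e]; apply: I1.
have As : A s by apply: AB => //; exact: IA.
have sI n : I (s ^+ n - 1).
  elim: n => [|n IH]; first by rewrite expr0 subrr.
  have -> : s ^+ n.+1 - 1 = s * (s ^+ n - 1) + (- 1) * a by rewrite exprS /s; ring.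
  by apply: ID; apply: IM => //; exact: AN.
have : I (s ^+ size Q).
  rewrite -[s ^+ _]mulr1 -e horner_coef mulr_sumr; apply: I_sum => -[i ilt] _ /=.
  have -> : s ^+ size Q * (Q`_i * s^-1 ^+ i) = s ^+ (size Q - i) * Q`_i.
    rewrite -[X in s ^+ X * (_ * _)](subnK (ltnW ilt)) exprD exprVn.
    by field; rewrite expf_neq0.
  by apply: IM => //; exact: AX.
move=> h; have -> : 1 = s ^+ size Q + (-1) * (s ^+ size Q - 1) by ring.
by apply: ID => //; apply: IM => //; exact: AN.
Qed.

(** Multiplied by x^n, the relation R(1/x) = 1 expresses (1 - R_0) x^n by lower powers of x. As 1 -
    R_0 is a unit of [A], this eliminates the leading term of Q. *)
Let lower_degree x (Q R : {poly F}) : x != 0 ->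
  (forall i, I Q`_i) -> (forall i, I R`_i) -> Q.[x] = 1 -> R.[x^-1] = 1 ->
  (size R <= size Q)%N ->
  exists Q' : {poly F}, [/\ forall i, I Q'`_i, Q'.[x] = 1 & (size Q' < size Q)%N].
Proof.
move=> x0 IQ IR eQ eR; case eN : (size Q) => [|n].
  by move/eqP: eN eQ; rewrite size_poly_eq0 => /eqP ->; rewrite horner0 => /eqP; rewrite eq_sym oner_eq0.
move=> leR; have [s0 As] := unitI (IR 0%N).
set t := Q`_n / (1 - R`_0).
exists (\poly_(i < n) (Q`_i + t * R`_(n - i))); split.
- move=> i; rewrite coef_poly; case: ifP => // _; apply: ID => //; apply: IM => //.
  by apply: AM => //; exact: IA.
- rewrite horner_poly; under eq_bigr do rewrite mulrDl -mulrA.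
  rewrite big_split /= -mulr_sumr.
  have -> : \sum_(i < n) Q`_i * x ^+ i = 1 - Q`_n * x ^+ n.
    by rewrite -eQ horner_coef eN big_ord_recr /= addrK.
  have -> : \sum_(i < n) R`_(n - i) * x ^+ i = x ^+ n * (1 - R`_0).
    rewrite -[1 in RHS]eR (horner_coef_wide _ leR) big_ord_recl /= expr0 mulr1 addrAC subrr add0r.
    rewrite mulr_sumr [RHS](reindex_inj rev_ord_inj); apply: eq_bigr => -[i ilt] _ /=.
    have -> : bump 0 (n - i.+1) = (n - i)%N by rewrite /bump; lia.
    have {2}-> : n = (n - i + i)%N by lia.
    by rewrite exprVn exprD; field; rewrite expf_neq0.
  by rewrite /t; field.
exact: leq_ltn_trans (size_poly _ _) _.
Qed.

(** Descent on the total size: the longer relation is shortened by means of the other one. *)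
Let no_pair n x (Q R : {poly F}) : (size Q + size R <= n)%N -> x != 0 ->
  (forall i, I Q`_i) -> (forall i, I R`_i) -> Q.[x] = 1 -> R.[x^-1] = 1 -> False.
Proof.
elim: n x Q R => [|n IH] x Q R le x0 IQ IR eQ eR.
  move: eQ; suff -> : Q = 0 by rewrite horner0 => /eqP; rewrite eq_sym oner_eq0.
  by apply/eqP; rewrite -size_poly_eq0; lia.
have [h|h] := leqP (size R) (size Q).
  have [Q' [IQ' eQ' lt]] := lower_degree x0 IQ IR eQ eR h.
  by apply: (IH x Q' R) => //; lia.
have [||R' [IR' eR' lt]] := lower_degree _ IR IQ eR _ (ltnW h).
- by rewrite invr_eq0.
- by rewrite invrK.
by apply: (IH x Q R') => //; lia.
Qed.

Lemma maximal_lying_over_valuation_domain : is_valuation_domain A.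
Proof.
split=> // x x0; apply: contrapT => /not_orP[nx nxV].
have [Q IQ eQ] := adjoin nx; have [R IR eR] := adjoin nxV.
exact: (no_pair (leqnn _) x0 IQ IR eQ eR).
Qed.

End Chevalley.

(** Zorn's lemma, started at the image of [W], gives a maximal subring among those that meet F0 in
    [W]. *)
Lemma chevalley_extension (F0 F : fieldType) (j : {rmorphism F0 -> F}) (W : F0 -> Prop) :
  is_valuation_domain W ->
  exists W', is_valuation_domain W' /\ forall x, W' (j x) <-> W x.
Proof.
move=> hW; pose good (A : F -> Prop) :=
  [/\ A 1, (forall x y, A x -> A y -> A (x - y)),
     (forall x y, A x -> A y -> A (x * y)) & forall x, A (j x) <-> W x].
have [|C [A0 CA0] Cgood Ctot|A gA maxA] := @zorn_chain_union F good.
- exists (fun y => exists2 x, W x & y = j x); split.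
  + by exists 1; [exact: vd1|rewrite rmorph1].
  + by move=> _ _ [x Wx ->] [y Wy ->]; exists (x - y); [exact: vdB|rewrite rmorphB].
  + by move=> _ _ [x Wx ->] [y Wy ->]; exists (x * y); [exact: vdM|rewrite rmorphM].
  by move=> x; split=> [[y Wy /fmorph_inj ->]|Wx] //; exists x.
- have dir x y : (exists2 A, C A & A x) -> (exists2 A, C A & A y) ->
      exists2 A, C A & A x /\ A y.
    move=> [A CA Ax] [B CB By]; case: (Ctot _ _ CA CB) => h; first by exists B => //; split=> //; exact: h.
    by exists A => //; split=> //; exact: h.
  split.
  + by exists A0 => //; case: (Cgood _ CA0).
  + move=> x y hx hy; have [A CA [Ax Ay]] := dir _ _ hx hy; exists A => //.
    by case: (Cgood _ CA) => _ + _ _; apply.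
  + move=> x y hx hy; have [A CA [Ax Ay]] := dir _ _ hx hy; exists A => //.
    by case: (Cgood _ CA) => _ _ + _; apply.
  move=> x; split=> [[A CA]|Wx]; first by case: (Cgood _ CA) => _ _ _ ->.
  by exists A0 => //; case: (Cgood _ CA0) => _ _ _ ->.
by exists A; split; [exact: (maximal_lying_over_valuation_domain hW gA maxA)|case: gA].
Qed.

(** * Norms of polynomials over the roots of a polynomial *)

Lemma mmap_comp_mpoly (R S : comNzRingType) (n k : nat) (f : {rmorphism R -> S})
    (v : 'I_k -> S) (lq : n.-tuple {mpoly R[k]}) (t : {mpoly R[n]}) :
  mmap f v (t \mPo lq) = mmap f (fun i => mmap f v (tnth lq i)) t.
Proof.
transitivity (\sum_(m <- msupp t) f t@_m * mmap1 (fun i => mmap f v (tnth lq i)) m) => //.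
rewrite comp_mpolyE raddf_sum; refine (eq_bigr _ _) => m _ /=.
rewrite mmapZ rmorph_prod; congr (_ * _).
by apply: eq_bigr => i _; rewrite rmorphXn.
Qed.

Lemma mmap_mesym_polyC (R : comNzRingType) (M : idomainType) (n k : nat)
    (f : {rmorphism R -> {poly M}}) (rs : n.-tuple M) :
  mmap f (fun i => (tnth rs i)%:P) (mesym n R k) = ((mesym n M k).@[tnth rs])%:P.
Proof.
rewrite !mesymE (raddf_sum (meval (tnth rs))) (raddf_sum polyC) raddf_sum /=.
refine (eq_bigr _ _) => h _.
rewrite mmapX mevalX rmorph_prod; apply: eq_bigr => i _.
by rewrite rmorphXn.
Qed.

(** The product is symmetric in the roots, hence a polynomial in their elementary symmetric
    functions, which are the coefficients of [p] up to sign. One [G] serves every splitting of [p],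
    so roots under two embeddings can be compared. *)
Lemma prod_over_roots_descends (E : fieldType) (p q : {poly E}) :
  exists G : {poly E}, forall (M : fieldType) (h : {rmorphism E -> M}) (rs : seq M),
    map_poly h p = \prod_(r <- rs) ('X - r%:P) ->
    map_poly h G = \prod_(r <- rs) ('X - ((map_poly h q).[r])%:P).
Proof.
(* The variable of [G] belongs to the coefficient ring [R], so that symmetry concerns the [n] roots
   only. *)
set n := (size p).-1; pose R := {poly E}.
pose c : {rmorphism E -> {mpoly R[n]}} := [the {rmorphism _ -> _} of @mpolyC n R \o polyC].
pose T i : {mpoly R[n]} := 'X%:MP - (map_poly c q).['X_i].
have symT : (\prod_(i < n) T i) \is symmetric.
  apply/issymP => s; rewrite rmorph_prod /=.
  rewrite [RHS](reindex_inj (@perm_inj _ s)); apply: eq_bigr => i _.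
  rewrite rmorphB /= {1}/msym mmapC; congr (_ - _).
  rewrite -horner_map /= -map_poly_comp; congr (_.[_]).
    by apply: eq_map_poly => x /=; rewrite /= /msym mmapC.
  by rewrite /msym mmapX mmap1U.
have [t [et _]] := sym_fundamental symT.
(* [p] is monic as soon as it splits in the required form, so these are the elementary symmetric
   functions of its roots, from degree 1 on. *)
exists (t.@[fun i => ((-1) ^+ i.+1 * p`_(n - i.+1))%:P]) => M h rs ep.
have sz : size rs = n.
  by rewrite /n -(size_map_poly h) ep size_prod_XsubC.
pose f : {rmorphism R -> {poly M}} := [the {rmorphism _ -> _} of map_poly h].
pose rt : n.-tuple M := tcast sz (in_tuple rs).
have ert : rs = rt by rewrite val_tcast.
have er : \prod_(r <- rs) ('X - ((map_poly h q).[r])%:P) =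
    mmap f (fun i => (tnth rt i)%:P) (\prod_(i < n) T i).
  rewrite rmorph_prod ert big_tuple; apply: eq_bigr => i _.
  rewrite rmorphB /= mmapC /= map_polyX; congr (_ - _).
  rewrite -horner_map /= -map_poly_comp -horner_map /=.
  rewrite mmapX mmap1U -map_poly_comp; congr (_.[_]).
  by apply: eq_map_poly => x /=; rewrite mmapC /= map_polyC.
rewrite er -et mmap_comp_mpoly.
have -> : map_poly h t.@[fun i => ((-1) ^+ i.+1 * p`_(n - i.+1))%:P] =
   mmap f (fun i : 'I_n => f ((-1) ^+ i.+1 * p`_(n - i.+1))%:P) t.
  rewrite mevalE rmorph_sum; refine (eq_bigr _ _) => m _ /=.
  rewrite rmorphM; congr (_ * _); rewrite rmorph_prod; apply: eq_bigr => i _.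
  by rewrite rmorphXn.
congr (mmap _ _ _); apply/funext => i.
rewrite tnth_mktuple mmap_mesym_polyC /= map_polyC /=; congr (_%:P).
rewrite rmorphM rmorphXn rmorphN1.
have := mroots_coeff rt (lift ord0 i); rewrite -ert -ep coef_map /= /bump /= add1n => ->.
by rewrite mulrA -exprD addnn -signr_odd odd_double expr0 mul1r.
Qed.

(** * Factors of primitive polynomials, and values of algebraic elements *)

Section PrimitiveFactors.
Variables (F : fieldType) (W : F -> Prop).
Hypothesis hW : is_valuation_domain W.

(** With [f = a *: f1] and [f1] primitive, [f1 * g] is primitive by Gauss's lemma, so that [a] must
    be a unit. *)
Lemma primitive_factor (f g : {poly F}) :
  primitive_poly W (f * g) -> primitive_poly W g -> primitive_poly W f.
Proof.
move=> pfg pg; have f0 : f != 0.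
  by apply: contraNneq (primitive_neq0 hW pfg) => ->; rewrite mul0r.
have [a [f1 [a0 ef pf]]] := primitive_part hW f0.
move: pfg; rewrite ef -scalerAl => -[ia [i ni]].
have Wa : W a by apply/(primitive_integralZ hW a (primitiveM hW pf pg)).
split; first by apply: vd_polyZ => //; case: pf.
have nma : ~ max_ideal W a.
  move=> ma; apply: ni; rewrite coefZ; apply: max_idealMr => //.
  by case: (primitiveM hW pf pg).
case: pf => _ [k nk]; exists k; rewrite coefZ; exact: max_ideal_prime.
Qed.
End PrimitiveFactors.

Lemma max_ideal_coefM (F : fieldType) (W : F -> Prop) (f g : {poly F}) :
  is_valuation_domain W -> (forall i, max_ideal W f`_i) -> vd_poly W g ->
  forall i, max_ideal W (f * g)`_i.
Proof.
move=> hW mf ig i; rewrite coefM; apply: max_ideal_sum => // k _.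
exact: max_idealMr.
Qed.

Lemma primitive_XsubC (F : fieldType) (W : F -> Prop) (a : F) :
  is_valuation_domain W -> W a -> primitive_poly W ('X - a%:P).
Proof.
move=> hW Wa; split=> [i|]; last first.
  by exists 1%N; rewrite coefB coefX coefC subr0; exact: max_ideal1.
rewrite coefB coefX coefC; apply: vdB => //.
  by case: eqP => _; [exact: vd1|exact: vd0].
by case: eqP => _ //; exact: vd0.
Qed.

Lemma primitive_scaleX_sub1 (F : fieldType) (W : F -> Prop) (a : F) :
  is_valuation_domain W -> W a -> primitive_poly W (a *: 'X - 1).
Proof.
move=> hW Wa; split=> [i|]; last first.
  exists 0%N; rewrite coefB coefZ coefX coef1 mulr0 sub0r => /(max_idealN hW).
  by rewrite opprK; exact: max_ideal1.
rewrite coefB coefZ coefX coef1; apply: vdB => //.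
  by apply: vdM => //; case: eqP => _; [exact: vd1|exact: vd0].
by case: eqP => _; [exact: vd1|exact: vd0].
Qed.

(** For [a] outside [W] the primitive multiple of X - a is X / a - 1. Hence a f is primitive, and
    1/a lies in the maximal ideal. *)
Lemma cofactor_XsubC_max_ideal (F : fieldType) (W : F -> Prop) (f : {poly F}) (a : F) :
  is_valuation_domain W -> primitive_poly W (f * ('X - a%:P)) -> ~ W a ->
  forall i, max_ideal W f`_i.
Proof.
move=> hW pfg nWa.
have [a0 Wai mai] := not_vd hW nWa.
have pg := primitive_scaleX_sub1 hW Wai.
have e : f * ('X - a%:P) = (a *: f) * (a^-1 *: 'X - 1).
  rewrite -scalerAl scalerAr scalerBr scalerA divff // scale1r.
  by rewrite alg_polyC.
move: pfg; rewrite e => /(primitive_factor hW)/(_ pg)[If _] i.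
have -> : f`_i = a^-1 * (a *: f)`_i by rewrite coefZ mulrA mulVf // mul1r.
exact: max_idealMr.
Qed.

Lemma cofactor_XsubC_integral (F : fieldType) (W : F -> Prop) (f : {poly F}) (a : F) :
  is_valuation_domain W -> primitive_poly W (f * ('X - a%:P)) -> vd_poly W f.
Proof.
move=> hW pfg; have [Wa|nWa] := pselect (W a).
  by have [] := primitive_factor hW pfg (primitive_XsubC hW Wa).
by move=> i; case: (cofactor_XsubC_max_ideal hW pfg nWa i).
Qed.

Lemma prod_XsubC_coef_max_ideal (F : fieldType) (W : F -> Prop) (s : seq F) :
  is_valuation_domain W -> (forall x, x \in s -> max_ideal W x) ->
  forall i, (i < size s)%N -> max_ideal W (\prod_(x <- s) ('X - x%:P))`_i.
Proof.
move=> hW; elim: s => // a s IH hs i.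
have hs' x : x \in s -> max_ideal W x by move=> xs; apply: hs; rewrite inE xs orbT.
have ma : max_ideal W a by apply: hs; rewrite mem_head.
rewrite /= ltnS big_cons mulrBl coefB coefXM coefCM => le.
apply: max_idealB => //; last first.
  apply: max_idealMr => //.
  have [+ _] : primitive_poly W (\prod_(x <- s) ('X - x%:P)); last exact.
  by refine (primitive_prod hW _) => x xs; apply: primitive_XsubC => //; case: (hs' x xs).
case: eqP => [_|]; first exact: max_ideal0.
by case: i le => // i le _; exact: IH.
Qed.

(** In the relation A(y) = 0 two nonzero terms share the least value, so some power of y has the
    value of a quotient of coefficients of A. *)
Lemma algebraic_value_torsion (E M : fieldType) (h : {rmorphism E -> M}) (W : M -> Prop)
    (A : {poly E}) (y : M) :
  is_valuation_domain W -> A != 0 -> root (map_poly h A) y -> y != 0 ->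
  exists m e, [/\ (0 < m)%N, e != 0, W (y ^+ m / h e) & W (h e / y ^+ m)].
Proof.
move=> hW A0 /eqP rA y0.
pose t i := h A`_i * y ^+ i.
have sum0 : \sum_(i < size A) t i = 0.
  rewrite -[RHS]rA horner_coef size_map_poly; apply: eq_bigr => i _.
  by rewrite coef_map.
pose T := \poly_(i < size A) t i.
have tE i : T`_i = t i.
  rewrite coef_poly; case: ltnP => // h'; rewrite /t nth_default // rmorph0 mul0r //.
have T0 : T != 0.
  apply/eqP => T0; move/eqP: (tE (size A).-1); rewrite T0 coef0 eq_sym mulf_eq0.
  by rewrite expf_eq0 (negPf y0) andbF orbF fmorph_eq0 -lead_coefE lead_coef_eq0 (negPf A0).
have [j tj0 jmin] := content_ex hW T0; rewrite tE in tj0.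
have {}jmin i : vle W (t j) (t i) by rewrite -!tE.
(* Were the least value attained only once, division of the relation by that term would put 1 into
   the maximal ideal. *)
have [i [ij ti0 le]] : exists i, [/\ i != j, t i != 0 & vle W (t i) (t j)].
  apply: contrapT => none.
  have jlt : (j < size A)%N.
    rewrite ltnNge; apply: contraNN tj0 => /(nth_default 0) e.
    by rewrite /t e rmorph0 mul0r.
  move/eqP: sum0; rewrite (bigD1 (Ordinal jlt)) //= addr_eq0 => /eqP e.
  have : max_ideal W (t j / t j).
    rewrite {1}e mulNr; apply: max_idealN => //; rewrite mulr_suml; apply: max_ideal_sum => // i ij.
    apply: contrapT => nm; apply: none; exists (nat_of_ord i); split.
    - by apply: contraNneq ij => ij; apply/eqP/val_inj.
    - by apply: contra_notN nm => /eqP ->; rewrite mul0r; exact: max_ideal0.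
    by apply: contrapT => /(not_vle hW tj0).
  by rewrite divff //; exact: max_ideal1.
have hA k : t k != 0 -> A`_k != 0 by apply: contraNneq => Ak; rewrite /t Ak rmorph0 mul0r.
have Wij : W (t i / t j) by apply/vleP.
have Wji : W (t j / t i) by apply/vleP.
have key a b : (a < b)%N -> t a != 0 -> t b != 0 ->
    y ^+ (b - a) / h (A`_a / A`_b) = t b / t a.
  move=> ab ta tb; have ha : h A`_a != 0 by rewrite fmorph_eq0 hA.
  have hb : h A`_b != 0 by rewrite fmorph_eq0 hA.
  have ya : y ^+ a != 0 by rewrite expf_neq0.
  have eb : y ^+ b = y ^+ (b - a) * y ^+ a by rewrite -exprD subnK // ltnW.
  rewrite /t eb fmorph_div; field.
  by rewrite ha hb ya.
have fin a b : (a < b)%N -> t a != 0 -> t b != 0 -> W (t a / t b) -> W (t b / t a) ->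
  exists m e, [/\ (0 < m)%N, e != 0, W (y ^+ m / h e) & W (h e / y ^+ m)].
  move=> ab ta tb wab wba; exists (b - a)%N, (A`_a / A`_b); split.
  - by rewrite subn_gt0.
  - by rewrite mulf_neq0 ?invr_eq0 ?hA.
  - by rewrite key.
  by rewrite -invf_div key // invf_div.
by move: ij; rewrite neq_ltn => /orP[lt|lt]; [apply: (fin i j)|apply: (fin j i)].
Qed.

(** * Conjugacy of extensions of a valuation *)

(** Elements of h(E)[b] are represented by polynomials over [E], so that their conjugates are
    evaluations of the same polynomial at other points. *)
Definition eval_via (E M : fieldType) (h : {rmorphism E -> M}) (b : M) (z : {poly E}) : M :=
  (map_poly h z).[b].

Section EvalVia.
Variables (E M : fieldType) (h : {rmorphism E -> M}) (b : M).

Lemma eval_via_is_zmod_morphism : zmod_morphism (eval_via h b).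
Proof. by move=> x y; rewrite /eval_via rmorphB hornerD hornerN. Qed.

Lemma eval_via_is_monoid_morphism : monoid_morphism (eval_via h b).
Proof. by split=> [|x y]; rewrite /eval_via ?rmorph1 ?hornerC // rmorphM hornerM. Qed.

HB.instance Definition _ := GRing.isZmodMorphism.Build _ _ (eval_via h b)
  eval_via_is_zmod_morphism.
HB.instance Definition _ := GRing.isMonoidMorphism.Build _ _ (eval_via h b)
  eval_via_is_monoid_morphism.

Lemma eval_viaC (x : E) : eval_via h b x%:P = h x.
Proof. by rewrite /eval_via map_polyC hornerC. Qed.

Lemma map_eval_via_polyC (A : {poly E}) : map_poly (eval_via h b) (map_poly polyC A) = map_poly h A.
Proof. by rewrite -map_poly_comp; apply: eq_map_poly => x /=; rewrite eval_viaC. Qed.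

Lemma eval_via_comp (A z : {poly E}) :
  eval_via h b (A \Po z) = (map_poly h A).[eval_via h b z].
Proof. by rewrite -map_eval_via_polyC horner_map. Qed.

End EvalVia.

Section ConjugateStep.
Variables (E M : fieldType) (h1 h2 : {rmorphism E -> M}) (W1 W2 : M -> Prop).
Hypotheses (hW1 : is_valuation_domain W1) (hW2 : is_valuation_domain W2).
Hypothesis agree : forall x, W1 (h1 x) <-> W2 (h2 x).
Variables (p : {poly E}) (rs1 rs2 : seq M) (beta : M).
Hypotheses (p1 : map_poly h1 p = \prod_(r <- rs1) ('X - r%:P))
  (p2 : map_poly h2 p = \prod_(r <- rs2) ('X - r%:P))
  (beta_root : beta \in rs1)
  (p_min : forall P, eval_via h1 beta P = 0 -> p %| P).

Local Notation ev1 := (eval_via h1 beta).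

Let agree_max x : max_ideal W1 (h1 x) <-> max_ideal W2 (h2 x).
Proof.
have [->|x0] := eqVneq x 0; first by rewrite !rmorph0; split=> _; exact: max_ideal0.
by rewrite !max_idealP ?fmorph_eq0 // -!fmorphV agree.
Qed.

Let ev1p : ev1 p = 0.
Proof. by rewrite /eval_via p1; apply/eqP; rewrite -/(root _ _) root_prod_XsubC. Qed.

Let ev2p r : r \in rs2 -> eval_via h2 r p = 0.
Proof. by move=> hr; rewrite /eval_via p2; apply/eqP; rewrite -/(root _ _) root_prod_XsubC. Qed.

(** By minimality of [p], sending [beta] to a conjugate [r] is well defined on h1(E)[beta]. *)
Lemma conjugate_eval_eq0 r P : r \in rs2 -> ev1 P = 0 -> eval_via h2 r P = 0.
Proof. by move=> hr /p_min/dvdpP[Q ->]; rewrite rmorphM /= ev2p // mulr0. Qed.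

Let p0 : p != 0.
Proof.
rewrite -(map_poly_eq0 h1) p1 monic_neq0 //; exact: monic_prod_XsubC.
Qed.

Let inverse z : ev1 z != 0 -> exists z', ev1 (z * z') = 1.
Proof.
move=> z0; have : coprimep z p.
  set d := gcdp z p; have /dvdpP[e ep] : d %| p by exact: dvdp_gcdr.
  have /dvdpP[u eu] : d %| z by exact: dvdp_gcdl.
  have d1 : ev1 d != 0 by apply: contraNneq z0 => d0; rewrite eu rmorphM /= d0 mulr0.
  have /p_min/dvdpP[g eg] : ev1 e = 0.
    by move/eqP: ev1p; rewrite ep rmorphM mulf_eq0 (negPf d1) orbF => /eqP.
  have /(mulfI p0) gd : p * (g * d) = p * 1 by rewrite mulr1 [RHS]ep eg; ring.
  by rewrite /coprimep -/d -dvdp1; apply/dvdpP; exists g.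
move=> /Bezout_eq1_coprimepP[[u v] /= e]; exists u.
by have := congr1 ev1 e; rewrite rmorphD !rmorphM rmorph1 /= ev1p mulr0 addr0 mulrC.
Qed.

(** A Bezout cofactor modulo [p] inverts [z] at [beta], and by [conjugate_eval_eq0] also at [r]. *)
Lemma conjugate_eval_inv r z : r \in rs2 -> ev1 z != 0 -> exists z',
  [/\ eval_via h2 r z != 0, ev1 z' = (ev1 z)^-1 & eval_via h2 r z' = (eval_via h2 r z)^-1].
Proof.
move=> hr z0; have [z' ezz] := inverse z0; exists z'.
have ezz2 : eval_via h2 r (z * z') = 1.
  apply/eqP; rewrite -(rmorph1 (eval_via h2 r)) -subr_eq0 -rmorphB.
  by apply/eqP/conjugate_eval_eq0 => //; rewrite rmorphB /= ezz rmorph1 subrr.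
rewrite rmorphM /= in ezz; rewrite rmorphM /= in ezz2.
have z20 : eval_via h2 r z != 0.
  by apply/eqP => z20; move/eqP: ezz2; rewrite z20 mul0r eq_sym oner_eq0.
by split=> //; [apply: (mulfI z0); rewrite ezz divff|apply: (mulfI z20); rewrite ezz2 divff].
Qed.

(** [prod_over_roots_descends] is applied to both splittings of [p]: one monic [A] over [E] takes
    care of [beta] and of all conjugates. *)
Let annihilator z : exists A : {poly E},
  [/\ A \is monic, (map_poly h1 A).[ev1 z] = 0 &
     map_poly h2 A = \prod_(r <- rs2) ('X - (eval_via h2 r z)%:P)].
Proof.
have [A hA] := prod_over_roots_descends p z; exists A.
have e1 := hA _ _ _ p1; have e2 := hA _ _ _ p2; split => //.
  by rewrite -(map_monic h1) e1 monic_prod_XsubC.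
rewrite e1; apply/eqP; rewrite -/(root _ _).
rewrite -(big_map (fun r => (map_poly h1 z).[r]) predT (fun r => 'X - r%:P)).
by rewrite root_prod_XsubC; apply: map_f.
Qed.

(* [A(Z) = (Z - z) Q(Z)] for a primitive annihilator [A] of [z]: by Gauss, the
   content of [Q] has in every conjugate the valuation [- min (0, v z)]. *)
Let separator r z : r \in rs2 -> W1 (ev1 z) -> ~ W2 (eval_via h2 r z) ->
  exists Q : {poly {poly E}},
    [/\ primitive_poly W1 (map_poly ev1 Q),
        forall r', r' \in rs2 -> vd_poly W2 (map_poly (eval_via h2 r') Q) &
        forall i, max_ideal W2 (eval_via h2 r Q`_i)].
Proof.
move=> hr W1z nW2z; have [G [monG G1 _]] := annihilator z.
have hWE := vd_pullback h1 hW1.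
have [a [A [a0 eG [iA [k nk]]]]] := primitive_part hWE (monic_neq0 monG).
have maxE := @max_ideal_pullback _ _ h1 _ W1 hWE hW1 (fun x => iff_refl _).
have pA1 : primitive_poly W1 (map_poly h1 A).
  by split=> [i|]; [rewrite coef_map; exact: iA|exists k; rewrite coef_map /= maxE].
have pA2 : primitive_poly W2 (map_poly h2 A).
  split=> [i|]; first by rewrite coef_map /= -agree; exact: iA.
  by exists k; rewrite coef_map /= -agree_max maxE.
have Az : ev1 (A \Po z) = 0.
  rewrite eval_via_comp; move/eqP: G1; rewrite eG map_polyZ hornerZ mulf_eq0.
  by rewrite fmorph_eq0 (negPf a0) => /eqP.
(* The constant A(z) vanishes at [beta] and at every conjugate, so a single [Q] over E[T]
   specializes to the cofactor of Z - z at all of them. *)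
have : root (map_poly polyC A - (A \Po z)%:P) z.
  by rewrite /root hornerD hornerN hornerC subrr.
move=> /factor_theorem[Q eQ]; exists Q.
have ev (b : M) (h : {rmorphism E -> M}) : eval_via h b (A \Po z) = 0 ->
    map_poly h A = map_poly (eval_via h b) Q * ('X - (eval_via h b z)%:P).
  move=> h0; have := congr1 (map_poly (eval_via h b)) eQ.
  by rewrite rmorphB rmorphM rmorphB /= !map_polyC /= h0 subr0 map_polyX map_eval_via_polyC.
split=> [|r' hr' |i].
- by move: pA1; rewrite (ev _ _ Az) => /(primitive_factor hW1); apply; exact: primitive_XsubC.
- move: pA2; rewrite (ev _ _ (conjugate_eval_eq0 hr' Az)); exact: cofactor_XsubC_integral.
rewrite -coef_map; apply: (cofactor_XsubC_max_ideal hW2 _ nW2z).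
by rewrite -(ev _ _ (conjugate_eval_eq0 hr Az)).
Qed.

Let dominated : exists2 r, r \in rs2 & forall z, W1 (ev1 z) -> W2 (eval_via h2 r z).
Proof.
apply: contrapT => none.
have /choice[Q hQ] : forall r, exists Q : {poly {poly E}}, r \in rs2 ->
    [/\ primitive_poly W1 (map_poly ev1 Q),
        forall r', r' \in rs2 -> vd_poly W2 (map_poly (eval_via h2 r') Q) &
        forall i, max_ideal W2 (eval_via h2 r Q`_i)].
  move=> r; have [hr|_] := boolP (r \in rs2); last by exists 0.
  have [z [W1z nW2z]] : exists z, W1 (ev1 z) /\ ~ W2 (eval_via h2 r z).
    apply: contrapT => nz; apply: none; exists r => // z W1z; apply: contrapT => nW2z.
    by apply: nz; exists z.
  by have [Q hQ] := separator hr W1z nW2z; exists Q.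
(* At [beta] the product stays primitive; at each [r] its factor [Q r] puts all coefficients into
   the maximal ideal. A unit coefficient at [beta] is the element sought. *)
pose P := \prod_(r <- rs2) Q r.
have [iP [k nk]] : primitive_poly W1 (map_poly ev1 P).
  rewrite rmorph_prod; refine (primitive_prod hW1 _) => r hr.
  by have [] := hQ r hr.
have mP r : r \in rs2 -> max_ideal W2 (eval_via h2 r P`_k).
  move=> hr; rewrite -coef_map rmorph_prod (big_rem r) //=.
  apply: max_ideal_coefM => // [i|]; first by rewrite coef_map; have [_ _] := hQ r hr; apply.
  rewrite big_seq; elim/big_rec: _ => [|r' f hr' hf].
    by case: (primitive1 hW2).
  apply: vd_polyM => //; have [_ + _] := hQ r' (mem_rem hr').
  by apply.
rewrite coef_map /= in nk; have W1q : W1 (ev1 P`_k) by rewrite -coef_map; exact: iP.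
(* The roots of [G] under [h2] lie in the maximal ideal, hence so do its lower coefficients. The
   equation at [beta] then puts a power of a unit into the maximal ideal. *)
have [G [monG G1 G2]] := annihilator P`_k.
have sG : size G = (size rs2).+1 by rewrite -(size_map_poly h2) G2 size_prod_XsubC.
have Glow i : (i < size rs2)%N -> max_ideal W1 (h1 G`_i).
  move=> lt; rewrite agree_max -coef_map G2.
  rewrite -(big_map (fun r => eval_via h2 r P`_k) predT (fun r => 'X - r%:P)).
  apply: prod_XsubC_coef_max_ideal => //; last by rewrite size_map.
  by move=> x /mapP[r hr ->]; exact: mP.
have lc : G`_(size rs2) = 1 by move/monicP: monG; rewrite /lead_coef sG.
apply: (@max_ideal_exp _ _ hW1 _ (size rs2) nk).
move: G1; rewrite horner_coef size_map_poly sG big_ord_recr /= coef_map /= lc rmorph1 mul1r.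
rewrite addrC => /eqP; rewrite addr_eq0 => /eqP ->.
apply: max_idealN => //; apply: max_ideal_sum => // i _.
by rewrite coef_map; apply: max_idealMr => //; [exact: vdX|exact: Glow].
Qed.

(** Inclusion becomes equality because values are torsion over [E]. If [z] is not integral at
    [beta], a power z'^m of its inverse z' has the value of some e in both maximal ideals. By
    inclusion z'^m / e is integral at [r]; if [z] is so too, 1 = (z z')^m lies in the maximal
    ideal. *)
Lemma conjugate_simple_extension :
  exists2 r, r \in rs2 & forall z, W1 (eval_via h1 beta z) <-> W2 (eval_via h2 r z).
Proof.
have [r hr hdom] := dominated; exists r => // z; split; first exact: hdom.
move=> W2z; apply: contrapT => nW1z.
have [z0 _ mz] := not_vd hW1 nW1z.
have [z' [z20 ez' ez2']] := conjugate_eval_inv hr z0.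
have [A [monA A1 _]] := annihilator z'.
have z'0 : ev1 z' != 0 by rewrite ez' invr_eq0.
have rA : root (map_poly h1 A) (ev1 z') by apply/eqP.
have [m [e [m0 e0 Wa Wb]]] := algebraic_value_torsion hW1 (monic_neq0 monA) rA z'0.
have me : max_ideal W2 (h2 e).
  apply/agree_max; have -> : h1 e = h1 e / ev1 z' ^+ m * ev1 z' ^+ m by rewrite divfK ?expf_neq0.
  by apply: max_idealM => //; apply: max_idealX => //; rewrite ez'.
have : W2 (eval_via h2 r (z' ^+ m * (e^-1)%:P)).
  by apply: hdom; rewrite rmorphM rmorphXn /= eval_viaC fmorphV.
rewrite rmorphM rmorphXn /= eval_viaC fmorphV => Wc.
have e20 : h2 e != 0 by rewrite fmorph_eq0.
have : max_ideal W2 ((eval_via h2 r z * eval_via h2 r z') ^+ m).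
  rewrite exprMn.
  have -> : eval_via h2 r z ^+ m * eval_via h2 r z' ^+ m =
     eval_via h2 r z ^+ m * (eval_via h2 r z' ^+ m * (h2 e)^-1) * h2 e by rewrite -!mulrA mulVf ?mulr1.
  by apply: max_idealM => //; apply: vdM => //; exact: vdX.
by apply: max_ideal_exp => //; rewrite ez2' divff //; exact: max_ideal1.
Qed.

End ConjugateStep.

(** * Subfields as field types, and extension of partial isomorphisms *)

Section SubfieldType.
Variables (M : fieldType) (D : divringClosed M).

Inductive subfield_type := SubfieldElt x & x \in D.
Definition subfield_val u := let: SubfieldElt x _ := u in x.

HB.instance Definition _ := [isSub for subfield_val].
HB.instance Definition _ := [Choice of subfield_type by <:].
HB.instance Definition _ := [SubChoice_isSubUnitRing of subfield_type by <:].
HB.instance Definition _ := [SubNzRing_isSubComNzRing of subfield_type by <:].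
HB.instance Definition _ := [SubComUnitRing_isSubIntegralDomain of subfield_type by <:].
HB.instance Definition _ := [SubIntegralDomain_isSubField of subfield_type by <:].

End SubfieldType.

(** Gives the domain of a partial isomorphism the form of a field type with an embedding, to which
    [conjugate_simple_extension] applies. *)
Lemma subfield_ex (M : fieldType) (D : M -> Prop) :
  D 1 -> (forall x y, D x -> D y -> D (x - y)) -> (forall x y, D x -> D y -> D (x * y)) ->
  (forall x, D x -> D x^-1) ->
  exists (E : fieldType) (h : {rmorphism E -> M}),
    (forall e, D (h e)) /\ (forall x, D x -> exists e, h e = x).
Proof.
move=> D1 DB DM DV; pose D' : {pred M} := fun x => `[< D x >].
have hD : divring_closed D'.
  split=> [|x y /asboolP Dx /asboolP Dy|x y /asboolP Dx /asboolP Dy]; apply/asboolP => //.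
    exact: DB.
  by apply: DM => //; exact: DV.
pose D'' : divringClosed M := HB.pack D' (GRing.isDivringClosed.Build M D' hD).
pose E : fieldType := subfield_type D''.
exists E, [the {rmorphism E -> M} of val]; split=> [e|x Dx].
  by have /asboolP := valP e.
have xD : x \in D'' by apply/asboolP.
by exists (SubfieldElt xD).
Qed.

(** The field [M] will be L(X), which is not algebraically closed, so splitting is asked for each
    element separately. *)
Definition normal_over (F0 M : fieldType) (j : {rmorphism F0 -> M}) (b : M) :=
  exists (p : {poly F0}) (rs : seq M),
    map_poly j p = \prod_(r <- rs) ('X - r%:P) /\ b \in rs.

Section Conjugacy.
Variables (F0 M : fieldType) (j : {rmorphism F0 -> M}) (W1 W2 : M -> Prop).
Hypotheses (hW1 : is_valuation_domain W1) (hW2 : is_valuation_domain W2).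
Hypothesis agree : forall x, W1 (j x) <-> W2 (j x).

(* Graphs of isomorphisms over F0 between subfields of M carrying W1 to W2. *)
Let partial_conj (S : M * M -> Prop) :=
  [/\ forall x, S (j x, j x),
      forall x y x' y', S (x, y) -> S (x', y') -> S (x - x', y - y') /\ S (x * x', y * y'),
      forall x y, S (x, y) -> S (x^-1, y^-1),
      forall y, S (0, y) -> y = 0 &
      forall x y, S (x, y) -> W1 x <-> W2 y].

Let maximal_ex : exists2 S, partial_conj S &
  forall B, partial_conj B -> (forall t, S t -> B t) -> forall t, B t -> S t.
Proof.
apply: zorn_chain_union.
  exists (fun p => exists x, p = (j x, j x)); split.
  - by move=> x; exists x.
  - move=> _ _ _ _ [x [-> ->]] [y [-> ->]].
    by split; [exists (x - y); rewrite rmorphB|exists (x * y); rewrite rmorphM].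
  - by move=> _ _ [x [-> ->]]; exists x^-1; rewrite fmorphV.
  - by move=> y [x [/esym/eqP]]; rewrite fmorph_eq0 => /eqP -> ->; rewrite rmorph0.
  by move=> _ _ [x [-> ->]].
move=> C [A0 CA0] Cgood Ctot.
have dir x y : (exists2 A, C A & A x) -> (exists2 A, C A & A y) ->
    exists2 A, C A & A x /\ A y.
  move=> [A CA Ax] [B CB By]; case: (Ctot _ _ CA CB) => h.
    by exists B => //; split=> //; exact: h.
  by exists A => //; split=> //; exact: h.
split.
- by move=> x; exists A0 => //; have [] := Cgood _ CA0.
- move=> x y x' y' hx hy; have [A CA [Ax Ay]] := dir _ _ hx hy.
  by have [_ + _ _ _] := Cgood _ CA; move=> /(_ _ _ _ _ Ax Ay)[]; split; exists A.
- move=> x y [A CA Axy]; exists A => //; have [_ _ + _ _] := Cgood _ CA; exact.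
- by move=> y [A CA Ay]; have [_ _ _ + _] := Cgood _ CA; apply.
by move=> x y [A CA Axy]; have [_ _ _ _ ] := Cgood _ CA; apply.
Qed.

(** The minimal polynomial of b over the domain [E] of [S] divides [p0], hence splits under both
    embeddings of [E], the inclusion [h1] and the map [h2] given by [S]. So [S] extends to b, and by
    maximality it already contains the extension. *)
Let domain_normal S : partial_conj S ->
  (forall B, partial_conj B -> (forall t, S t -> B t) -> forall t, B t -> S t) ->
  forall b, normal_over j b -> exists y, S (b, y).
Proof.
move=> [Sj SBM SV S0 SW] maxS b [p0 [rs0 [ep0 brs0]]].
have SB x y x' y' (h : S (x, y)) (h' : S (x', y')) := (SBM _ _ _ _ h h').1.
have SM x y x' y' (h : S (x, y)) (h' : S (x', y')) := (SBM _ _ _ _ h h').2.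
have Sfun x y y' : S (x, y) -> S (x, y') -> y = y'.
  move=> h h'; apply/eqP; rewrite -subr_eq0; apply/eqP/S0.
  by rewrite -[X in (X, _)](subrr x); exact: SB.
have [||||E [h1 [Dh1 h1D]]] := @subfield_ex M (fun x => exists y, S (x, y)).
- by exists (j 1); rewrite -(rmorph1 j).
- by move=> x x' [y h] [y' h']; exists (y - y'); exact: SB.
- by move=> x x' [y h] [y' h']; exists (y * y'); exact: SM.
- by move=> x [y h]; exists y^-1; exact: SV.
have /choice[f hf] : forall e, exists y, S (h1 e, y) by [].
have fA : zmod_morphism f by move=> x y; apply: (Sfun (h1 (x - y))) => //; rewrite rmorphB; exact: SB.
have fM : monoid_morphism f.
  split=> [|x y]; last by apply: (Sfun (h1 (x * y))) => //; rewrite rmorphM; exact: SM.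
  by apply: (Sfun (h1 1)) => //; rewrite rmorph1 -(rmorph1 j).
pose h2 : {rmorphism E -> M} := HB.pack f (GRing.isZmodMorphism.Build _ _ f fA)
  (GRing.isMonoidMorphism.Build _ _ f fM).
have {}hf e : S (h1 e, h2 e) by exact: hf.
have agreeE x : W1 (h1 x) <-> W2 (h2 x) by exact: SW.
have /choice[jE hjE] : forall x, exists e, h1 e = j x by move=> x; apply: h1D; exists (j x).
have h2j x : h2 (jE x) = j x by apply: (Sfun (h1 (jE x))) => //; rewrite hjE.
pose pE := \poly_(i < size p0) jE p0`_i.
have coefpE (h : {rmorphism E -> M}) : (forall x, h (jE x) = j x) -> map_poly h pE = map_poly j p0.
  move=> hj; apply/polyP => i; rewrite !coef_map coef_poly; case: ltnP => le; first exact: hj.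
  by rewrite nth_default // !raddf0.
have pE1 := coefpE h1 hjE; have pE2 := coefpE h2 h2j.
have [p [monp p_b pmin]] : exists p : {poly E}, [/\ p \is monic, eval_via h1 b p = 0 &
    forall P, eval_via h1 b P = 0 -> p %| P].
  have ex : exists n, `[< exists p : {poly E}, [/\ p \is monic, eval_via h1 b p = 0 & size p = n] >].
    exists (size pE); apply/asboolP; exists pE; split => //.
      by rewrite -(map_monic h1) pE1 ep0 monic_prod_XsubC.
    by rewrite /eval_via pE1 ep0; apply/eqP; rewrite -/(root _ _) root_prod_XsubC.
  case: (ex_minnP ex) => n /asboolP[p [monp pb sp]] nmin; exists p; split => // P Pb.
  rewrite /dvdp; apply/contraT => r0.
  set R := P %% p in r0.
  have Rb : eval_via h1 b R = 0.
    by move: Pb; rewrite {1}(divp_eq P p) rmorphD rmorphM /= pb mulr0 add0r.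
  have : `[< exists q : {poly E}, [/\ q \is monic, eval_via h1 b q = 0 & size q = size R] >].
    apply/asboolP; exists ((lead_coef R)^-1 *: R).
    rewrite monicE lead_coefZ mulVf ?lead_coef_eq0 // eqxx; split=> //.
      by rewrite -mul_polyC rmorphM /= Rb mulr0.
    by rewrite size_scale // invr_eq0 lead_coef_eq0.
  by move/nmin; rewrite leqNgt -sp ltn_modp monic_neq0.
have p_pE : p %| pE.
  by apply: pmin; rewrite /eval_via pE1 ep0; apply/eqP; rewrite -/(root _ _) root_prod_XsubC.
have splits (h : {rmorphism E -> M}) : map_poly h pE = map_poly j p0 ->
    exists rs, map_poly h p = \prod_(r <- rs) ('X - r%:P).
  move=> e; have : map_poly h p %| \prod_(r <- rs0) ('X - r%:P).
    by rewrite -ep0 -e dvdp_map.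
  move=> /dvdp_prod_XsubC[m]; rewrite eqp_monic ?map_monic ?monic_prod_XsubC //.
  by move=> /eqP em; exists (mask m rs0).
have [rs1 ep1] := splits _ pE1; have [rs2 ep2] := splits _ pE2.
have brs1 : b \in rs1 by rewrite -root_prod_XsubC -ep1; apply/eqP.
have [r hr conj] := conjugate_simple_extension hW1 hW2 agreeE ep1 ep2 brs1 pmin.
exists r.
(* The larger graph sends z(b) to z(r) for every polynomial z over [E]. *)
apply: (maxS (fun t => exists z, t = (eval_via h1 b z, eval_via h2 r z))); last first.
- by exists 'X; rewrite /eval_via !map_polyX !hornerX.
- move=> [x y] Sxy; have [e he] := h1D x (ex_intro _ y Sxy).
  exists e%:P; rewrite !eval_viaC he; congr (_, _).
  by apply: (Sfun x) => //; rewrite -he.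
split.
- by move=> x; exists (jE x)%:P; rewrite !eval_viaC hjE h2j.
- move=> _ _ _ _ [z [-> ->]] [z' [-> ->]].
  by split; [exists (z - z'); rewrite !rmorphB|exists (z * z'); rewrite !rmorphM].
- move=> _ _ [z [-> ->]]; have [z0|z0] := eqVneq (eval_via h1 b z) 0.
    exists 0; rewrite !rmorph0 z0 (conjugate_eval_eq0 ep2 pmin hr z0) //.
    by rewrite invr0.
  have [z' [_ e1 e2]] := conjugate_eval_inv ep1 ep2 brs1 pmin hr z0.
  by exists z'; rewrite e1 e2.
- by move=> y [z [/esym z0 ->]]; exact: (conjugate_eval_eq0 ep2 pmin hr z0).
by move=> _ _ [z [-> ->]].
Qed.

(** The hypothesis says that the image of [j] and the elements normal over it generate [M] as a
    field; by [domain_normal] the domain of a maximal partial isomorphism contains them. *)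
Lemma conjugate_valuations :
  (forall D : M -> Prop, D 1 -> (forall x y, D x -> D y -> D (x - y)) ->
     (forall x y, D x -> D y -> D (x * y)) -> (forall x, D x -> D x^-1) ->
     (forall x, D (j x)) -> (forall b, normal_over j b -> D b) -> forall x, D x) ->
  exists sigma : {rmorphism M -> M},
    (forall x, sigma (j x) = j x) /\ (forall x, W1 x <-> W2 (sigma x)).
Proof.
move=> gen; have [S gS maxS] := maximal_ex; have [Sj SBM SV S0 SW] := gS.
have SB x y x' y' (h : S (x, y)) (h' : S (x', y')) := (SBM _ _ _ _ h h').1.
have SM x y x' y' (h : S (x, y)) (h' : S (x', y')) := (SBM _ _ _ _ h h').2.
have Sfun x y y' : S (x, y) -> S (x, y') -> y = y'.
  move=> h h'; apply/eqP; rewrite -subr_eq0; apply/eqP/S0.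
  by rewrite -[X in (X, _)](subrr x); exact: SB.
have /choice[f hf] : forall x, exists y, S (x, y).
  apply: gen.
  - by exists (j 1); rewrite -(rmorph1 j).
  - by move=> x x' [y h] [y' h']; exists (y - y'); exact: SB.
  - by move=> x x' [y h] [y' h']; exists (y * y'); exact: SM.
  - by move=> x [y h]; exists y^-1; exact: SV.
  - by move=> x; exists (j x).
  exact: domain_normal.
have fA : zmod_morphism f by move=> x y; apply: (Sfun (x - y)) => //; exact: SB.
have fM : monoid_morphism f.
  split=> [|x y]; last by apply: (Sfun (x * y)) => //; exact: SM.
  by apply: (Sfun 1) => //; rewrite -(rmorph1 j).
pose s : {rmorphism M -> M} := HB.pack f (GRing.isZmodMorphism.Build _ _ f fA)
  (GRing.isMonoidMorphism.Build _ _ f fM).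
exists s.
split=> x /=; last exact: SW.
by apply: (Sfun (j x)).
Qed.
End Conjugacy.

Lemma vle_pullback (F0 F : fieldType) (h : {rmorphism F0 -> F}) (W0 : F0 -> Prop)
    (W : F -> Prop) :
  (forall x, W (h x) <-> W0 x) -> forall x y, vle W (h x) (h y) <-> vle W0 x y.
Proof.
move=> hh x y; rewrite /vle fmorph_eq0 -fmorph_div hh.
split=> -[/eqP|]; rewrite ?fmorph_eq0; try by right.
  by move=> /eqP; left.
by move=> /eqP ->; left; rewrite rmorph0.
Qed.

Lemma gauss_le_pullback (F0 F : fieldType) (h : {rmorphism F0 -> F}) (W0 : F0 -> Prop)
    (W : F -> Prop) (g f : {poly F0}) : (forall x, W (h x) <-> W0 x) ->
  gauss_le W (map_poly h g) (map_poly h f) <-> gauss_le W0 g f.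
Proof.
move=> hh; split=> -[k hk]; exists k => i; have := hk i; rewrite !coef_map /=.
  by rewrite (vle_pullback hh).
by rewrite (vle_pullback hh).
Qed.

(** * Embeddings of the algebraic closure over K, and conjugacy over K(X) *)

Definition fraction_const (L : fieldType) : {rmorphism L -> {fraction {poly L}}} :=
  [the {rmorphism L -> {fraction {poly L}}} of @FracField.tofrac {poly L} \o polyC].

Lemma closed_field_split (K : fieldType) (L : closedFieldType) (iota : {rmorphism K -> L})
    (x : L) : (exists p : {poly K}, p != 0 /\ root (map_poly iota p) x) ->
  exists (p : {poly K}) (rs : seq L),
    [/\ p \is monic, map_poly iota p = \prod_(r <- rs) ('X - r%:P) & x \in rs].
Proof.
move=> [p [p0 px]]; have [rs ers] := closed_field_poly_normal (map_poly iota p).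
have l0 : lead_coef p != 0 by rewrite lead_coef_eq0.
exists ((lead_coef p)^-1 *: p), rs; split.
- by rewrite monicE lead_coefZ mulVf.
- rewrite map_polyZ {1}ers lead_coef_map scalerA fmorphV mulVf ?scale1r //.
  by rewrite fmorph_eq0.
by move: px; rewrite ers rootZ ?root_prod_XsubC // lead_coef_map fmorph_eq0.
Qed.

Section AlgebraicClosure.
Variables (K : fieldType) (L : closedFieldType) (iota : {rmorphism K -> L}).
Hypothesis Lalg : forall x : L, exists p : {poly K}, p != 0 /\ root (map_poly iota p) x.

Lemma finite_stable_roots (s : {rmorphism L -> L}) (x : L) :
  (forall k, s (iota k) = iota k) ->
  exists2 rs : seq L, x \in rs & forall y, y \in rs -> s y \in rs.
Proof.
move=> sK; have [p [rs [_ ep xrs]]] := closed_field_split (Lalg x).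
exists rs => // y; rewrite -!root_prod_XsubC -ep => /rootP ry.
apply/rootP; have e : map_poly s (map_poly iota p) = map_poly iota p.
  by rewrite -map_poly_comp; apply: eq_map_poly => k /=; rewrite sK.
by rewrite -e horner_map ry rmorph0.
Qed.

(** The injective [s] maps a finite set of roots into itself, hence onto itself, and every element
    lies in such a set. *)
Lemma embedding_bijective (s : {rmorphism L -> L}) :
  (forall k, s (iota k) = iota k) -> bijective s.
Proof.
move=> sK; have surj y : exists x, s x = y.
  have [rs yrs srs] := finite_stable_roots y sK.
  have us : uniq (map s (undup rs)) by rewrite map_inj_uniq ?undup_uniq //; exact: fmorph_inj.
  have sub : {subset map s (undup rs) <= undup rs}.
    by move=> _ /mapP[x xs ->]; rewrite mem_undup srs // -mem_undup.
  have [_ es] := uniq_min_size us sub (eq_leq (esym (size_map _ _))).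
  have : y \in map s (undup rs) by rewrite es mem_undup.
  by move=> /mapP[x _ ->]; exists x.
have [t ht] := choice surj; exists t => // x.
by apply: (fmorph_inj s); rewrite ht.
Qed.

(** The iterates of [x] stay among finitely many roots, so two of them agree, and injectivity
    cancels the earlier one. *)
Lemma embedding_periodic (s : {rmorphism L -> L}) (x : L) :
  (forall k, s (iota k) = iota k) -> exists2 n, (0 < n)%N & iter n s x = x.
Proof.
move=> sK; have [rs xrs srs] := finite_stable_roots x sK.
have itrs i : iter i s x \in rs by elim: i => //= i IH; exact: srs.
have : ~~ uniq (traject s x (size rs).+1).
  have sub : {subset traject s x (size rs).+1 <= rs} by move=> y /trajectP[i _ ->].
  by apply/negP => us; have := uniq_leq_size us sub; rewrite size_traject ltnn.
rewrite looping_uniq negbK => /trajectP[i ilt e].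
exists (size rs - i)%N; first by rewrite subn_gt0.
have inj k : injective (iter k s).
  by elim: k => [|k IH] a b //= /fmorph_inj; exact: IH.
by apply: (inj i); rewrite -iterD subnKC // ltnW.
Qed.

Lemma fraction_generated (D : {fraction {poly L}} -> Prop) :
  (forall x y, D x -> D y -> D (x - y)) -> (forall x y, D x -> D y -> D (x * y)) ->
  (forall x, D x -> D x^-1) -> D ('X)%:F -> (forall l, D (fraction_const L l)) ->
  forall x, D x.
Proof.
move=> DB DM DV DX Dc.
have D0 : D 0 by have := Dc 0; rewrite rmorph0.
have DD x y : D x -> D y -> D (x + y).
  by move=> Dx Dy; rewrite -(opprK y); apply: (DB) => //; rewrite -sub0r; exact: DB.
have Dp (f : {poly L}) : D f%:F.
  elim/poly_ind: f => [|f c IH]; first by rewrite tofrac0.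
  by rewrite tofracD tofracM; apply: (DD); [exact: DM|exact: Dc].
move=> x; have [f [g [g0 ->]]] := fraction_ex x.
by apply: (DM) => //; exact: DV.
Qed.

Lemma normal_over_const (l : L) : normal_over (embedKX iota) (fraction_const L l).
Proof.
have [p [rs [_ ep lrs]]] := closed_field_split (Lalg l).
exists (map_poly (fraction_const K) p), (map (fraction_const L) rs); split; last exact: map_f.
rewrite -map_poly_comp (eq_map_poly (g := fraction_const L \o iota)); last first.
  by move=> k; rewrite /= embedKX_poly map_polyC.
rewrite map_poly_comp ep rmorph_prod big_map; apply: eq_bigr => r _.
by rewrite rmorphB /= map_polyX map_polyC.
Qed.

(** A conjugating endomorphism of L(X) over K(X) fixes X and maps constants to constants, so it acts
    on coefficients through some [tau] over K. *)
Lemma conjugate_over_KX (W1 W2 : {fraction {poly L}} -> Prop) :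
  is_valuation_domain W1 -> is_valuation_domain W2 ->
  (forall phi, W1 (embedKX iota phi) <-> W2 (embedKX iota phi)) ->
  exists tau : {rmorphism L -> L}, (forall k, tau (iota k) = iota k) /\
    forall f g : {poly L},
      W1 (f%:F / g%:F) <-> W2 ((map_poly tau f)%:F / (map_poly tau g)%:F).
Proof.
move=> hW1 hW2 agree.
have [|s [sj sW]] := conjugate_valuations hW1 hW2 agree.
  move=> D D1 DB DM DV Dj Dn; apply: fraction_generated => //.
    by have := Dj ('X)%:F; rewrite /= embedKX_poly map_polyX.
  by move=> l; apply: Dn; exact: normal_over_const.
have sX : s ('X)%:F = ('X)%:F by have := sj ('X)%:F; rewrite /= embedKX_poly map_polyX.
have cinj : injective (fraction_const L) by exact: fmorph_inj.
(* The image of a constant is a root of the same polynomial over K, all of whose roots in L(X) are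
   constants. *)
have /choice[tau htau] : forall l, exists l', s (fraction_const L l) = fraction_const L l'.
  move=> l; have [P [rs [eP lrs]]] := normal_over_const l.
  have [p [rs' [_ ep lrs']]] := closed_field_split (Lalg l).
  have rt : root (map_poly (fraction_const L) (map_poly iota p)) (s (fraction_const L l)).
    have /rootP r0 : root (map_poly (fraction_const L) (map_poly iota p)) (fraction_const L l).
      by rewrite fmorph_root ep root_prod_XsubC.
    apply/rootP; have e : map_poly s (map_poly (fraction_const L) (map_poly iota p)) =
        map_poly (fraction_const L) (map_poly iota p).
      apply/polyP => i; rewrite !coef_map /=.
      by have := sj ((p`_i)%:P)%:F; rewrite /= embedKX_poly map_polyC.
    by rewrite -e horner_map r0 rmorph0.
  move: rt; rewrite ep rmorph_prod /=.
  under eq_bigr do rewrite rmorphB /= map_polyX map_polyC /=.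
  by rewrite -(big_map (fraction_const L) predT (fun r => 'X - r%:P)) root_prod_XsubC
     => /mapP[r _ ->]; exists r.
have fA : zmod_morphism tau by move=> x y; apply: cinj; rewrite -htau !rmorphB -!htau.
have fM : monoid_morphism tau.
  split=> [|x y]; first by apply: cinj; rewrite -htau !rmorph1.
  by apply: cinj; rewrite -htau !rmorphM -!htau.
have {tau htau fA fM} [t htau] : exists t : {rmorphism L -> L},
    forall l, s (fraction_const L l) = fraction_const L (t l).
  by exists (HB.pack_for {rmorphism L -> L} tau (GRing.isZmodMorphism.Build _ _ tau fA)
    (GRing.isMonoidMorphism.Build _ _ tau fM)).
have sp (f : {poly L}) : s f%:F = (map_poly t f)%:F.
  elim/poly_ind: f => [|f c IH]; first by rewrite !rmorph0.
  rewrite (rmorphD (map_poly t)) (rmorphM (map_poly t)) /= map_polyX map_polyC.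
  rewrite !tofracD !tofracM !rmorphD !rmorphM /= IH sX.
  by congr (_ + _); exact: htau.
exists t; split=> [k|f g].
  apply: cinj; rewrite -htau.
  by have := sj (k%:P)%:F; rewrite /= embedKX_poly map_polyC.
by rewrite sW rmorphM fmorphV /= !sp.
Qed.

End AlgebraicClosure.

(** * Balls and orbits *)

Section Composition.
Variables (F : fieldType) (W : F -> Prop).
Hypothesis hW : is_valuation_domain W.

Lemma vd_polyX (f : {poly F}) n : vd_poly W f -> vd_poly W (f ^+ n).
Proof.
move=> hf; elim: n => [|n IH]; rewrite ?expr0 ?exprS; last exact: vd_polyM.
by case: (primitive1 hW).
Qed.

Lemma vd_poly_comp (f q : {poly F}) : vd_poly W f -> vd_poly W q -> vd_poly W (f \Po q).
Proof.
move=> hf hq i; rewrite comp_polyE coef_sum; apply: vd_sum => // k _.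
by rewrite coefZ; apply: vdM => //; exact: vd_polyX.
Qed.

Lemma max_ideal_coef_comp (f q : {poly F}) :
  (forall i, max_ideal W f`_i) -> vd_poly W q -> forall i, max_ideal W (f \Po q)`_i.
Proof.
move=> hf hq i; rewrite comp_polyE coef_sum; apply: max_ideal_sum => // k _.
by rewrite coefZ; apply: max_idealMr => //; exact: vd_polyX.
Qed.

(* If [j] is the lowest index of a unit coefficient of [P], then modulo the
   maximal ideal [P (G) = G^j S] where [S (0)] is that coefficient. *)
Lemma primitive_comp (P G : {poly F}) :
  primitive_poly W P -> primitive_poly W G -> G`_0 = 0 -> primitive_poly W (P \Po G).
Proof.
move=> pP pG G0; have [j nj lej] := primitive_lowest pP.
have [iP _] := pP; have [iG _] := pG.
split; first exact: vd_poly_comp.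
have mt i : max_ideal W (take_poly j P \Po G)`_i.
  apply: max_ideal_coef_comp => // k; rewrite coef_take_poly; case: ltnP => [/lej //|_].
  exact: max_ideal0.
have pd : primitive_poly W (drop_poly j P \Po G).
  split; first by apply: vd_poly_comp => // k; rewrite coef_drop_poly.
  by exists 0%N; rewrite -horner_coef0 horner_comp !horner_coef0 G0 horner_coef0 coef_drop_poly.
have [_ [k nk]] : primitive_poly W ((drop_poly j P \Po G) * G ^+ j).
  by apply: primitiveM => //; exact: primitiveX.
exists k; rewrite -(poly_take_drop j P) comp_polyD comp_polyM comp_Xn_poly coefD addrC.
exact: unit_addr.
Qed.

(** As [c] is a unit, the substitution is invertible over [W] and therefore preserves
    primitivity. *)
Lemma gauss_le_affine_subst (alpha c : F) (g f : {poly F}) : c != 0 -> g != 0 ->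
  W alpha -> W c -> W c^-1 ->
  gauss_le W g f -> gauss_le W (affine_subst alpha c g) (affine_subst alpha c f).
Proof.
move=> c0 g0 Wa Wc Wci; have [b [G [b0 -> pG]]] := primitive_part hW g0.
have iq (x y : F) : W x -> W y -> vd_poly W (x *: 'X + y%:P).
  move=> Wx Wy i; rewrite coefD coefZ coefX coefC; apply: vdD => //.
    by apply: vdM => //; case: eqP => _; [exact: vd1|exact: vd0].
  by case: eqP => _ //; exact: vd0.
have pG' : primitive_poly W (affine_subst alpha c G).
  have G0 : affine_subst alpha c G != 0 by rewrite affine_subst_eq0 // (primitive_neq0 hW pG).
  have [iG _] := pG.
  have [a [H [a0 eH [iH [k nk]]]]] := primitive_part hW G0.
  split; first by apply: vd_poly_comp => //; exact: iq.
  (* The substitution X -> (X - alpha) / c undoes the given one. *)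
  have e : G = a *: affine_subst (- (alpha / c)) c^-1 H.
    rewrite /affine_subst -comp_polyZ -eH /affine_subst -comp_polyA.
    rewrite comp_polyD comp_polyZ comp_polyX comp_polyC.
    rewrite scalerDr scalerA divff // scale1r -mul_polyC -polyCM mulrN mulrC divfK //.
    by rewrite polyCN addrNK comp_polyXr.
  exists k; rewrite eH coefZ; apply: max_ideal_prime => // ma.
  have [_ [l nl]] := pG; apply: nl; rewrite e coefZ; apply: max_idealMr => //.
  by apply: vd_poly_comp => //; apply: iq => //; apply: vdN => //; exact: vdM.
rewrite gauss_leE // /affine_subst comp_polyZ gauss_leE // => h.
by rewrite -comp_polyZ; apply: vd_poly_comp => //; exact: iq.
Qed.

End Composition.

(** * Balls and the monomial valuations they determine *)

Section SameBall.
Variables (F : fieldType) (U : F -> Prop).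
Hypothesis hU : is_valuation_domain U.
Implicit Types (alpha c : F).

(** Criterion for two pairs to define the same ball: equal radii, and one centre in the ball around
    the other. *)
Definition same_ball alpha c alpha' c' :=
  [/\ U (c' / c), U (c / c') & U ((alpha' - alpha) / c)].

Lemma same_ball_sym alpha c alpha' c' : c != 0 -> c' != 0 ->
  same_ball alpha c alpha' c' -> same_ball alpha' c' alpha c.
Proof.
move=> c0 c'0 [h1 h2 h3]; split=> //.
have -> : (alpha - alpha') / c' = - ((alpha' - alpha) / c * (c / c')) by field; rewrite c0 c'0.
by apply: vdN => //; exact: vdM.
Qed.

(** The change of parameters is the affine substitution with data (a' - a)/d and d'/d, the first
    integral and the second a unit. *)
Lemma mono_le_same_ball alpha c alpha' c' (g f : {poly F}) : c != 0 -> c' != 0 -> g != 0 ->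
  same_ball alpha c alpha' c' -> mono_le U alpha c g f <-> mono_le U alpha' c' g f.
Proof.
suff half a d a' d' : d != 0 -> d' != 0 -> g != 0 ->
    same_ball a d a' d' -> mono_le U a d g f -> mono_le U a' d' g f.
  by move=> c0 c'0 g0 h; split; apply: half => //; exact: same_ball_sym.
move=> d0 d'0 g0 [h1 h2 h3]; rewrite !mono_le_gauss.
have e h : affine_subst a' d' h = affine_subst ((a' - a) / d) (d' / d) (affine_subst a d h).
  rewrite /affine_subst -comp_polyA; congr (_ \Po _).
  rewrite comp_polyD comp_polyZ comp_polyX comp_polyC scalerDr scalerA mulrC divfK //.
  by rewrite scale_polyC [d * _]mulrC divfK // polyCB -addrA subrK.
rewrite !e; apply: gauss_le_affine_subst => //.
- by rewrite mulf_neq0 ?invr_eq0.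
- by rewrite affine_subst_eq0.
by rewrite invf_div.
Qed.

(** Two points of a ball suffice as tests, its centre a and a + d, whose difference is d. *)
Lemma ball_same_ball alpha c alpha' c' : c != 0 -> c' != 0 ->
  (forall x, ball U alpha c x <-> ball U alpha' c' x) -> same_ball alpha c alpha' c'.
Proof.
move=> c0 c'0 h.
have half a d a' d' : d != 0 -> d' != 0 -> (forall x, ball U a d x -> ball U a' d' x) ->
    U (d / d') /\ U ((a - a') / d').
  move=> d0 d'0 hb; have h1 : vle U d' (a - a').
    by apply: hb; rewrite /ball subrr; exact: vle0.
  have h2 : vle U d' (d + a - a').
    by apply: hb; rewrite /ball addrK; exact: vle_refl.
  move: (vleB hU h2 h1); rewrite (_ : d + a - a' - (a - a') = d); last by ring.
  by move=> h3; split; apply/vleP.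
have [h1 _] := half _ _ _ _ c0 c'0 (fun x => (h x).1).
have [h2 h3] := half _ _ _ _ c'0 c0 (fun x => (h x).2); by split.
Qed.

Lemma same_ball_ball alpha c alpha' c' : c != 0 -> c' != 0 ->
  same_ball alpha c alpha' c' -> forall x, ball U alpha c x <-> ball U alpha' c' x.
Proof.
move=> c0 c'0 hb x.
have half a d a' d' : d != 0 -> d' != 0 -> same_ball a d a' d' -> ball U a d x -> ball U a' d' x.
  move=> d0 d'0 [h1 h2 h3]; rewrite /ball !vleP // => h4.
  have -> : (x - a') / d' = ((x - a) / d - (a' - a) / d) * (d / d').
    by field; rewrite d0 d'0.
  by apply: vdM => //; exact: vdB.
by split; apply: half => //; exact: same_ball_sym.
Qed.

(** The test function is (X - a)/d, of value 0 for (a, d). Its integrality for (a', d') is read off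
    the coefficients of d' X + (a' - a); exchanging the pairs gives the remaining condition. *)
Lemma mono_le_inj alpha c alpha' c' : c != 0 -> c' != 0 ->
  (forall f g, g != 0 -> mono_le U alpha c g f <-> mono_le U alpha' c' g f) ->
  same_ball alpha c alpha' c'.
Proof.
move=> c0 c'0 h.
have leC e F0 : e != 0 -> gauss_le U e%:P F0 <-> forall i, vle U e F0`_i.
  move=> e0; rewrite -[e%:P]alg_polyC gauss_leE ?integral_vle //; first exact: primitive1.
have lin a e a' : affine_subst a e ('X - a'%:P) = e *: 'X + (a - a')%:P.
  by rewrite affine_substB affine_substC /affine_subst comp_polyX polyCB addrA.
have half a d a' d' : d != 0 -> d' != 0 ->
   (forall f g, g != 0 -> mono_le U a d g f -> mono_le U a' d' g f) ->
   U (d' / d) /\ U ((a' - a) / d).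
  move=> d0 d'0 hm; have : mono_le U a' d' d%:P ('X - a%:P).
    apply: hm; first by rewrite polyC_eq0.
    rewrite mono_le_gauss affine_substC lin leC // subrr addr0 => i.
    rewrite coefZ coefX; case: eqP => _; rewrite ?mulr1 ?mulr0; first exact: vle_refl.
    exact: vle0.
  rewrite mono_le_gauss affine_substC lin leC // => hi; split; apply/vleP => //.
    by have := hi 1%N; rewrite coefD coefZ coefX coefC mulr1 addr0.
  by have := hi 0%N; rewrite coefD coefZ coefX coefC mulr0 add0r.
have [h1 h3] := half _ _ _ _ c0 c'0 (fun f g g0 => (h f g g0).1).
have [h2 _] := half _ _ _ _ c'0 c0 (fun f g g0 => (h f g g0).2); by split.
Qed.

End SameBall.

Lemma mono_le_transport (L : fieldType) (s : {rmorphism L -> L}) (U1 U2 : L -> Prop)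
    (alpha c : L) (g f : {poly L}) : (forall x, U2 (s x) <-> U1 x) ->
  mono_le U2 (s alpha) (s c) (map_poly s g) (map_poly s f) <-> mono_le U1 alpha c g f.
Proof.
move=> hs; rewrite !mono_le_gauss.
have e h : affine_subst (s alpha) (s c) (map_poly s h) = map_poly s (affine_subst alpha c h).
  by rewrite /affine_subst map_comp_poly rmorphD /= map_polyZ map_polyX map_polyC.
rewrite !e; exact: gauss_le_pullback.
Qed.

(** * Action of automorphisms, and residual transcendence of monomial valuations *)

Section Orbits.
Variables (K : fieldType) (L : closedFieldType) (iota : {rmorphism K -> L}).
Hypothesis Lalg : forall x : L, exists p : {poly K}, p != 0 /\ root (map_poly iota p) x.

Lemma Theta_transport (s : {rmorphism L -> L}) (U1 U2 : L -> Prop) (alpha c : L) phi :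
  is_valuation_domain U1 -> is_valuation_domain U2 -> c != 0 ->
  (forall k, s (iota k) = iota k) -> (forall x, U2 (s x) <-> U1 x) ->
  Theta iota U1 alpha c phi <-> Theta iota U2 (s alpha) (s c) phi.
Proof.
move=> hU1 hU2 c0 sK hs; have [f [g [g0 ->]]] := fraction_ex phi.
rewrite !Theta_frac ?fmorph_eq0 //.
have e (h : {poly K}) : map_poly iota h = map_poly s (map_poly iota h).
  by rewrite -map_poly_comp; apply: eq_map_poly => k /=; rewrite sK.
have := mono_le_transport alpha c (map_poly iota g) (map_poly iota f) hs.
by rewrite -!e => ->.
Qed.

(* [s c / c] and its images under the powers of [s] multiply to 1 over a period of [c]. *)
Lemma automorphism_value (s : {rmorphism L -> L}) (U : L -> Prop) (c : L) :
  is_valuation_domain U -> c != 0 ->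
  (forall k, s (iota k) = iota k) -> (forall x, U (s x) <-> U x) ->
  U (s c / c) /\ U (c / s c).
Proof.
move=> hU c0 sK hs; have [n n0 en] := embedding_periodic Lalg c sK.
have itr0 x k : x != 0 -> iter k s x != 0.
  by move=> x0; elim: k => //= k; rewrite fmorph_eq0.
have itrm x k : max_ideal U x -> max_ideal U (iter k s x).
  by move=> mx; elim: k => //= k IH; apply/(max_ideal_pullback hU hU hs).
have itrM x y k : iter k s (x / y) = iter k s x / iter k s y.
  by elim: k => //= k ->; rewrite fmorph_div.
have tele x k : x != 0 -> \prod_(i < k) iter i s (s x / x) = iter k s x / x.
  move=> x0; elim: k => [|k IH]; first by rewrite big_ord0 divff.
  rewrite big_ord_recr /= IH itrM -iterSr /=; field.
  by rewrite itr0 // x0.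
have nm x : x != 0 -> iter n s x = x -> ~ max_ideal U (s x / x).
  move=> x0 ex mx; apply: (max_ideal1 hU).
  rewrite -(divff x0) -{1}ex -tele //.
  case: n n0 {en ex} => // n _; rewrite big_ord_recl /=.
  apply: max_idealMr => //; elim/big_ind: _ => [|a b|i _]; [exact: vd1|exact: vdM|].
  by case: (itrm _ i.+1 mx).
have sc0 : s c != 0 by rewrite fmorph_eq0.
have [_ h1] := not_max_ideal hU (nm _ c0 en).
have : ~ max_ideal U (s c^-1 / c^-1).
  apply: nm; first by rewrite invr_eq0.
  by rewrite -[c^-1]mul1r itrM en; congr (_ / _); elim: (n) => //= k ->; rewrite rmorph1.
move=> /(not_max_ideal hU)[_ h2].
have e : (s c^-1 / c^-1)^-1 = s c / c by rewrite fmorphV invfM !invrK.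
by split; [rewrite -e|rewrite -invf_div].
Qed.

Lemma Theta_valuation_domain (U : L -> Prop) (alpha c : L) :
  is_valuation_domain U -> c != 0 -> is_valuation_domain (Theta iota U alpha c).
Proof.
move=> hU c0; exact: (vd_pullback (embedKX iota) (monoU_valuation_domain hU alpha c0)).
Qed.

Lemma Theta_const (U : L -> Prop) (alpha c : L) (k : K) :
  is_valuation_domain U -> c != 0 -> Theta iota U alpha c (constKX k) <-> U (iota k).
Proof. by move=> hU c0; rewrite /Theta /constKX embedKX_poly map_polyC; exact: monoU_const. Qed.

(* The witness is [f^m / e], where [f (alpha) = 0] and [e] in K has the same value
   as [f^m]: after the substitution of [alpha + c X] it is a primitive polynomial
   without constant term. *)
Lemma Theta_residually_transcendental (V : K -> Prop) (U : L -> Prop) (alpha c : L) :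
  is_valuation_domain V ->
  is_valuation_domain U -> (forall k, U (iota k) <-> V k) -> c != 0 ->
  residually_transcendental V (Theta iota U alpha c).
Proof.
move=> hV hU hUV c0; have [f [f0 /rootP fa]] := Lalg alpha.
have F0 : affine_subst alpha c (map_poly iota f) != 0.
  by rewrite affine_subst_eq0 // map_poly_eq0.
have [d [F1 [d0 eF pF]]] := primitive_part hU F0.
have F1_0 : F1`_0 = 0.
  have : (affine_subst alpha c (map_poly iota f))`_0 = 0.
    by rewrite -horner_coef0 horner_comp hornerD hornerZ hornerX hornerC mulr0 add0r.
  by rewrite eF coefZ => /eqP; rewrite mulf_eq0 (negPf d0) => /eqP.
(* The content [d] is algebraic over K, so some power of it has the value of an element [e] of K. *)
have [A [A0 Ad]] := Lalg d.
have [m [e [m0 e0 Uk Uk']]] := algebraic_value_torsion hU A0 Ad d0.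
pose w : {fraction {poly K}} := (f ^+ m)%:F / (e%:P)%:F.
pose G' := (iota e)^-1 *: (map_poly iota f) ^+ m.
have ew : embedKX iota w = G'%:F.
  rewrite /w embedKX_frac ?polyC_eq0 // map_polyC rmorphXn /G'.
  have ie0 : ((iota e)%:P)%:F != 0 :> {fraction {poly L}}.
    by rewrite tofrac_eq0 polyC_eq0 fmorph_eq0.
  apply: (mulIf ie0); rewrite divfK // -tofracM; congr (_%:F).
  by rewrite mulrC mul_polyC scalerA divff ?scale1r // fmorph_eq0.
have eG : affine_subst alpha c G' = (d ^+ m / iota e) *: F1 ^+ m.
  rewrite /affine_subst comp_polyZ rmorphXn /= -/(affine_subst _ _ _) eF exprZn scalerA.
  by rewrite mulrC.
have pG : primitive_poly U (affine_subst alpha c G').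
  rewrite eG; split; first by apply: vd_polyZ => //; case: (primitiveX hU m pF).
  have [_ [k nk]] := primitiveX hU m pF; exists k; rewrite coefZ; apply: max_ideal_prime => //.
  rewrite max_idealP // ?invf_div; first by apply.
  by rewrite mulf_neq0 ?expf_neq0 // invr_eq0 fmorph_eq0.
have G0 : (affine_subst alpha c G')`_0 = 0.
  by rewrite eG coefZ -horner_coef0 horner_exp horner_coef0 F1_0 expr0n eqn0Ngt m0 mulr0.
(* Over L the element P(w) is the polynomial P composed with [G'], to which [primitive_comp]
   applies. *)
have evalw (P : {poly K}) : embedKX iota (map_poly (@constKX K) P).[w] =
    (map_poly iota P \Po G')%:F.
  have -> : map_poly (@constKX K) P = map_poly (fraction_const K) P by [].
  rewrite -horner_map /= ew /= -map_poly_comp.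
  have -> : map_poly (embedKX iota \o fraction_const K) P =
      map_poly (@FracField.tofrac {poly L}) (map_poly polyC (map_poly iota P)).
    by rewrite -!map_poly_comp; apply: eq_map_poly => k /=; rewrite embedKX_poly map_polyC.
  by rewrite horner_map.
have prim_frac (f1 g1 : {poly L}) : primitive_poly U (affine_subst alpha c f1) ->
    primitive_poly U (affine_subst alpha c g1) -> monoU U alpha c (f1%:F / g1%:F).
  move=> pf pg; have g0 : g1 != 0 by have := primitive_neq0 hU pg; rewrite affine_subst_eq0.
  rewrite monoU_frac // mono_le_gauss.
  have := @gauss_le_prim _ _ hU 1 _ 1 _ (oner_neq0 _) pg pf.
  by rewrite !scale1r divr1 => ->; exact: vd1.
have unitP (H : {poly L}) : primitive_poly U (affine_subst alpha c H) ->
    monoU U alpha c H%:F /\ monoU U alpha c (H%:F)^-1.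
  move=> pH; have p1 : primitive_poly U (affine_subst alpha c 1%:P).
    by rewrite affine_substC; exact: primitive1.
  have one1 : (1%:P : {poly L})%:F = 1 by rewrite !rmorph1.
  have := prim_frac _ _ pH p1; have := prim_frac _ _ p1 pH.
  by rewrite one1 divr1 mul1r.
exists w.
  by rewrite /Theta ew; have [] := unitP _ pG.
move=> P iP [i [Pi0 VPi VPii]].
have pP : primitive_poly U (map_poly iota P).
  split=> [k|]; first by rewrite coef_map hUV.
  by exists i; rewrite coef_map /= (max_ideal_pullback hV hU hUV) max_idealP //.
have pPG : primitive_poly U (affine_subst alpha c (map_poly iota P \Po G')).
  by rewrite /affine_subst -comp_polyA; apply: primitive_comp.
have [UP UPi] := unitP _ pPG.
move=> [_ [x0|]]; last by rewrite /Theta fmorphV /= evalw.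
have := primitive_neq0 hU pPG; rewrite affine_subst_eq0 //.
by rewrite -tofrac_eq0 -evalw x0 rmorph0 eqxx.
Qed.

End Orbits.

(** * Residually transcendental valuations over an algebraically closed field *)

Lemma vd_root (F : fieldType) (W : F -> Prop) (x : F) n :
  is_valuation_domain W -> (0 < n)%N -> W (x ^+ n) -> W x.
Proof.
move=> hW n0 Wx; apply: contrapT => nWx; have [x0 _ mx] := not_vd hW nWx.
have := max_idealX hW n0 mx; rewrite exprVn max_idealP ?invr_eq0 ?expf_neq0 //.
by rewrite invrK.
Qed.

Section OneUnits.
Variables (F : fieldType) (W : F -> Prop).
Hypothesis hW : is_valuation_domain W.

Definition one_unit (x : F) := max_ideal W (x - 1).

Lemma one_unitP x : one_unit x -> [/\ x != 0, W x & W x^-1].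
Proof.
move=> hx; have nm : ~ max_ideal W x.
  by rewrite -(subrK 1 x) addrC; apply: unit_addr => //; exact: max_ideal1.
have [x0 Wi] := not_max_ideal hW nm; split=> //.
by rewrite -(subrK 1 x); apply: vdD => //; [case: hx|exact: vd1].
Qed.

Lemma one_unit1 : one_unit 1.
Proof. by rewrite /one_unit subrr; exact: max_ideal0. Qed.

Lemma one_unitM x y : one_unit x -> one_unit y -> one_unit (x * y).
Proof.
move=> hx hy; rewrite /one_unit.
have -> : x * y - 1 = (x - 1) * y + (y - 1) by ring.
by apply: max_idealD => //; apply: max_idealMr => //; have [] := one_unitP hy.
Qed.

Lemma one_unitV x : one_unit x -> one_unit x^-1.
Proof.
move=> hx; have [x0 _ Wi] := one_unitP hx; rewrite /one_unit.
have -> : x^-1 - 1 = - ((x - 1) * x^-1) by field.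
by apply: max_idealN => //; exact: max_idealMr.
Qed.

End OneUnits.

Section ResiduallyTranscendental.
Variables (L : closedFieldType) (M : fieldType) (con : {rmorphism L -> M}) (X : M).
Hypothesis X_transcendental : forall f : {poly L}, f != 0 -> (map_poly con f).[X] != 0.
Variable (W : M -> Prop).
Hypothesis hW : is_valuation_domain W.

Let U (l : L) := W (con l).
Let hU : is_valuation_domain U := vd_pullback con hW.
Let lin (a : L) : M := X - con a.

Let con_neq0 d : d != 0 -> con d != 0.
Proof. by rewrite fmorph_eq0. Qed.

Let lin_neq0 a : lin a != 0.
Proof.
have /X_transcendental : 'X - a%:P != 0 by rewrite polyXsubC_eq0.
by rewrite rmorphB /= map_polyX map_polyC hornerD hornerN hornerX hornerC.
Qed.

Let linD a b : lin a = lin b + con (b - a).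
Proof. by rewrite /lin rmorphB /= addrA subrK. Qed.

Let max_con l : max_ideal W (con l) <-> max_ideal U l.
Proof. exact: max_ideal_pullback. Qed.

(* The subgroup generated by the constants, [Z] and the 1-units. *)
Let monomial_mod Z x := exists d n1 n2,
  d != 0 /\ one_unit W (x * Z ^+ n1 / (con d * Z ^+ n2)).

Let monomial_modM Z x y : Z != 0 ->
  monomial_mod Z x -> monomial_mod Z y -> monomial_mod Z (x * y).
Proof.
move=> Z0 [d [n1 [n2 [d0 h]]]] [d' [n1' [n2' [d'0 h']]]].
exists (d * d'), (n1 + n1')%N, (n2 + n2')%N; split; first by rewrite mulf_neq0.
rewrite (_ : _ / _ = (x * Z ^+ n1 / (con d * Z ^+ n2)) * (y * Z ^+ n1' / (con d' * Z ^+ n2'))).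
  exact: one_unitM.
by rewrite !exprD rmorphM /=; field; rewrite !con_neq0 // !expf_neq0.
Qed.

Let monomial_modV Z x : Z != 0 -> monomial_mod Z x -> monomial_mod Z x^-1.
Proof.
move=> Z0 [d [n1 [n2 [d0 h]]]]; exists d^-1, n2, n1; split; first by rewrite invr_eq0.
rewrite (_ : _ / _ = (x * Z ^+ n1 / (con d * Z ^+ n2))^-1); first exact: one_unitV.
by rewrite fmorphV !invfM !invrK; ring.
Qed.

Let monomial_mod_con Z d : d != 0 -> monomial_mod Z (con d).
Proof.
move=> d0; exists d, 0%N, 0%N; split=> //; rewrite !expr0 !mulr1 divff ?con_neq0 //.
exact: one_unit1.
Qed.

(** Both polynomials split over L, so finitely many linear factors decide. *)
Let monomial_mod_frac Z (f g : {poly L}) : Z != 0 -> f != 0 -> g != 0 ->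
  exists rs : seq L, (forall a, a \in rs -> monomial_mod Z (lin a)) ->
    monomial_mod Z ((map_poly con f).[X] / (map_poly con g).[X]).
Proof.
move=> Z0 f0 g0.
have [rf ef] := closed_field_poly_normal f; have [rg eg] := closed_field_poly_normal g.
exists (rf ++ rg) => h.
have prod (p : {poly L}) (rs : seq L) : p != 0 -> p = lead_coef p *: \prod_(z <- rs) ('X - z%:P) ->
    {subset rs <= rf ++ rg} -> monomial_mod Z (map_poly con p).[X].
  move=> p0 -> sub; rewrite map_polyZ hornerZ; apply: monomial_modM => //.
    by apply: monomial_mod_con; rewrite lead_coef_eq0.
  rewrite rmorph_prod horner_prod big_seq; elim/big_rec: _ => [|r x hr hx].
    by rewrite -(rmorph1 con); apply: monomial_mod_con; exact: oner_neq0.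
  apply: monomial_modM => //.
  rewrite rmorphB /= map_polyX map_polyC hornerD hornerN hornerX hornerC.
  by apply: h; exact: sub.
apply: monomial_modM => //; [|apply: monomial_modV => //].
  by apply: (prod f rf) => // r hr; rewrite mem_cat hr.
by apply: (prod g rg) => // r hr; rewrite mem_cat hr orbT.
Qed.

Let residue_const Z w d n : Z != 0 -> d != 0 -> W w ->
  one_unit W (w * Z ^+ n / (con d * Z ^+ n)) -> exists2 b, U b & max_ideal W (w - con b).
Proof.
move=> Z0 d0 Ww; have dc0 := con_neq0 d0.
rewrite (_ : _ / _ = w / con d); last by field; rewrite dc0 expf_neq0.
move=> hu; have [u0 Wu Wui] := one_unitP hW hu.
have Ud : U d.
  rewrite /U (_ : con d = w * (w / con d)^-1); first exact: vdM.
  have w0 : w != 0 by apply: contraNneq u0 => ->; rewrite mul0r.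
  by field; rewrite dc0 w0.
exists d => //; rewrite (_ : w - con d = con d * (w / con d - 1)); first exact: max_idealM.
by field.
Qed.

(** The residue field of [U] is algebraically closed because L is, so a residue is transcendental
    over it exactly when it is not that of a constant. *)
Let transcendental_residue w := W w /\ forall b, U b -> ~ max_ideal W (w - con b).

(** The value group of L is divisible, so being torsion modulo it means having the value of a
    constant. *)
Let torsion_value Z := exists d, [/\ d != 0, W (Z / con d) & W (con d / Z)].

(** Up to a 1-unit, w is d Z^n with n = n2 - n1. If Z = 1 or n = 0, then w has the residue of the
    constant d; otherwise a power of Z, and then Z itself, has the value of a constant. *)
Let not_monomial Z w : Z != 0 -> transcendental_residue w -> monomial_mod Z w ->
  (Z = 1 \/ ~ torsion_value Z) -> False.
Proof.
move=> Z0 [Ww tr] [d [n1 [n2 [d0 hu]]]] hZ.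
have nores n : one_unit W (w * Z ^+ n / (con d * Z ^+ n)) -> False.
  by move=> /(residue_const Z0 d0 Ww)[b Ub]; exact: tr.
case: hZ => [Z1|ntor].
  by apply: (nores 0%N); move: hu; rewrite Z1 !expr1n.
have dc0 := con_neq0 d0.
have nmw : ~ max_ideal W w by have := tr 0 (vd0 hU); rewrite rmorph0 subr0.
have [w0 Wwi] := not_max_ideal hW nmw.
have [u0 Wu Wui] := one_unitP hW hu.
(* A k-th root of [e] in L has the value of [Z], since a valuation domain is closed under extraction
   of roots. *)
have tors k e : (0 < k)%N -> e != 0 -> W (Z ^+ k / con e) -> W (con e / Z ^+ k) -> False.
  move=> k0 e0 h1 h2; have /closed_rootP[x] : size ('X^k - e%:P) != 1%N.
    by rewrite size_XnsubC // eqSS -lt0n.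
  rewrite /root hornerD hornerN hornerC hornerXn subr_eq0 => /eqP ex.
  have x0 : x != 0 by apply: contraNneq e0 => x0; rewrite -ex x0 expr0n eqn0Ngt k0.
  apply: ntor; exists x; split=> //; apply: (vd_root hW k0);
    by rewrite expr_div_n -rmorphXn /= ex.
have WZ : W (Z ^+ n1 / (con d * Z ^+ n2)).
  rewrite (_ : _ / _ = w^-1 * (w * Z ^+ n1 / (con d * Z ^+ n2))); first exact: vdM.
  by field; rewrite dc0 w0 expf_neq0.
have WZi : W (con d * Z ^+ n2 / Z ^+ n1).
  rewrite (_ : _ / _ = w * (w * Z ^+ n1 / (con d * Z ^+ n2))^-1); first exact: vdM.
  by field; rewrite dc0 w0 !expf_neq0.
case: (ltngtP n1 n2) => [lt|lt|en]; last by apply: (nores n1); rewrite {2}en.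
- have e : Z ^+ n2 = Z ^+ (n2 - n1) * Z ^+ n1 by rewrite -exprD subnK // ltnW.
  apply: (tors (n2 - n1)%N d^-1); rewrite ?subn_gt0 ?invr_eq0 // fmorphV.
    rewrite (_ : _ / _ = con d * Z ^+ n2 / Z ^+ n1) // e; field.
    by rewrite ?dc0 ?oner_neq0 !expf_neq0.
  rewrite (_ : _ / _ = Z ^+ n1 / (con d * Z ^+ n2)) // e; field.
  by rewrite ?dc0 ?oner_neq0 !expf_neq0.
have e : Z ^+ n1 = Z ^+ (n1 - n2) * Z ^+ n2 by rewrite -exprD subnK // ltnW.
apply: (tors (n1 - n2)%N d); rewrite ?subn_gt0 //.
  rewrite (_ : _ / _ = Z ^+ n1 / (con d * Z ^+ n2)) // e; field.
  by rewrite ?dc0 ?oner_neq0 !expf_neq0.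
rewrite (_ : _ / _ = con d * Z ^+ n2 / Z ^+ n1) // e; field.
by rewrite !expf_neq0.
Qed.

(** Each linear factor is proportional to a primitive one that is a unit at y: X - r for integral r,
    because y does not have the residue of r, and X / r - 1 otherwise, because its value at y is -1
    modulo the maximal ideal. *)
Let transcendental_horner y (P : {poly L}) : transcendental_residue y ->
  primitive_poly U P -> ~ max_ideal W (map_poly con P).[y].
Proof.
move=> [Wy tr] pP.
have linP (r : L) : exists a (P0 : {poly L}), [/\ a != 0, 'X - r%:P = a *: P0,
    primitive_poly U P0 & ~ max_ideal W (map_poly con P0).[y]].
  have [Ur|nUr] := pselect (U r).
    exists 1, ('X - r%:P); rewrite scale1r oner_neq0; split=> //.
      exact: primitive_XsubC.
    by rewrite rmorphB /= map_polyX map_polyC hornerD hornerN hornerX hornerC; exact: tr.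
  have [r0 Uri mri] := not_vd hU nUr.
  exists r, (r^-1 *: 'X - 1); split=> //.
  - by rewrite scalerBr scalerA divff // scale1r alg_polyC.
  - exact: primitive_scaleX_sub1.
  rewrite rmorphB rmorph1 /= map_polyZ map_polyX hornerD hornerN hornerZ hornerX hornerC addrC.
  apply: unit_addr => //; first by move=> /(max_idealN hW); rewrite opprK; exact: max_ideal1.
  by apply: max_idealMr => //; apply/max_con.
have prodP (s : seq L) : exists a (P0 : {poly L}), [/\ a != 0,
    \prod_(r <- s) ('X - r%:P) = a *: P0,
    primitive_poly U P0 & ~ max_ideal W (map_poly con P0).[y]].
  elim: s => [|r s [a [P0 [a0 eP pP0 nP0]]]].
    exists 1, 1; rewrite big_nil scale1r oner_neq0; split=> //; first exact: primitive1.
    by rewrite rmorph1 hornerC; exact: max_ideal1.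
  have [b [Q [b0 eQ pQ nQ]]] := linP r.
  exists (b * a), (Q * P0); rewrite mulf_neq0 // big_cons eP eQ; split=> //.
  - by rewrite -scalerAl -scalerAr scalerA.
  - exact: primitiveM.
  by rewrite rmorphM hornerM; exact: max_ideal_prime.
have [s es] := closed_field_poly_normal P; have [a [P0 [a0 eP pP0 nP0]]] := prodP s.
have l0 : lead_coef P != 0 by rewrite lead_coef_eq0 (primitive_neq0 hU pP).
rewrite es eP scalerA map_polyZ hornerZ; apply: max_ideal_prime => // /max_con ma.
have [_ [i ni]] := pP; apply: ni; rewrite es eP scalerA coefZ.
by apply: max_idealMr => //; case: pP0.
Qed.

(** Primitive polynomials take unit values at y = (X - beta)/c, so [W] induces the Gauss valuation
    in y. *)
Let mono_le_of_transcendental beta c (f g : {poly L}) : c != 0 ->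
  transcendental_residue (lin beta / con c) -> g != 0 ->
  W ((map_poly con f).[X] / (map_poly con g).[X]) <-> mono_le U beta c g f.
Proof.
move=> c0 tr g0; rewrite mono_le_gauss.
have cc0 := con_neq0 c0.
have ev (h : {poly L}) : (map_poly con h).[X] =
    (map_poly con (affine_subst beta c h)).[lin beta / con c].
  rewrite /affine_subst map_comp_poly horner_comp rmorphD /= map_polyZ map_polyX map_polyC.
  by rewrite hornerD hornerZ hornerX hornerC mulrCA divff // mulr1 subrK.
have [b [G [b0 eG pG]]] := affine_primitive_part hU beta c0 g0.
rewrite !ev eG; have [->|F0] := eqVneq (affine_subst beta c f) 0.
  rewrite rmorph0 horner0 mul0r; split=> _; [exact: gauss_le_0|exact: vd0].
have [a [F1 [a0 eF pF]]] := primitive_part hU F0.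
rewrite eF gauss_le_prim // !map_polyZ !hornerZ.
have [f0' Wfi] := not_max_ideal hW (transcendental_horner tr pF).
have [g0' Wgi] := not_max_ideal hW (transcendental_horner tr pG).
have Wev (h : {poly L}) : vd_poly U h -> W (map_poly con h).[lin beta / con c].
  move=> ih; rewrite horner_coef; apply: vd_sum => // i _; rewrite coef_map.
  by apply: vdM => //; [exact: ih|apply: vdX => //; case: tr].
have Wf := Wev _ (proj1 pF); have Wg := Wev _ (proj1 pG).
move: f0' Wfi g0' Wgi Wf Wg; set u := (map_poly con F1).[_]; set v := (map_poly con G).[_].
move=> u0 Wui v0 Wvi Wu Wv; rewrite /U fmorph_div.
have ca0 := con_neq0 a0; have cb0 := con_neq0 b0.
split=> h.
  rewrite (_ : _ / _ = (con a * u / (con b * v)) * u^-1 * v); first by do 2!apply: vdM => //.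
  by field; rewrite u0 cb0 v0.
rewrite (_ : _ / _ = (con a / con b) * u * v^-1); first by do 2!apply: vdM => //.
by field; rewrite cb0 v0.
Qed.

Lemma residually_transcendental_mono_le (f g : {poly L}) :
  let w := (map_poly con f).[X] / (map_poly con g).[X] in
  W w -> (forall b, W (con b) -> ~ max_ideal W (w - con b)) ->
  exists alpha c, c != 0 /\ forall f1 g1, g1 != 0 ->
    W ((map_poly con f1).[X] / (map_poly con g1).[X]) <->
    mono_le (fun l => W (con l)) alpha c g1 f1.
Proof.
move=> w Ww tr0; have tr : transcendental_residue w by [].
have w0 : w != 0.
  apply/eqP => w0; apply: (tr0 0); first by rewrite rmorph0; exact: vd0.
  by rewrite rmorph0 w0 subr0; exact: max_ideal0.
have f0 : f != 0.
  by apply: contraNneq w0 => f0; rewrite /w f0 rmorph0 horner0 mul0r.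
have g0 : g != 0.
  by apply: contraNneq w0 => g0; rewrite /w g0 rmorph0 horner0 invr0 mulr0.
apply: contrapT => none.
(* Otherwise the values of X - a and of a - b always differ, so X - b equals one of the two up to a
   1-unit, and w is monomial in Z = X - a. *)
have tors a : torsion_value (lin a).
  apply: contrapT => ntor.
  have [rs hrs] := monomial_mod_frac (lin_neq0 a) f0 g0.
  apply: (not_monomial (lin_neq0 a) tr (hrs _)); last by right.
  move=> b _; have [<-|ab] := eqVneq a b.
    exists 1, 0%N, 1%N; split; first exact: oner_neq0.
    by rewrite rmorph1 expr0 expr1 mulr1 mul1r divff ?lin_neq0 //; exact: one_unit1.
  have d0 : a - b != 0 by rewrite subr_eq0.
  have dc0 := con_neq0 d0.
  have eb := linD b a.
  have [h|h] := pselect (W (lin a / con (a - b))).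
    have nh : ~ W (con (a - b) / lin a) by move=> h'; apply: ntor; exists (a - b).
    exists (a - b), 0%N, 0%N; split=> //; rewrite !expr0 !mulr1 eb /one_unit.
    rewrite (_ : _ - 1 = lin a / con (a - b)); last by rewrite mulrDl divff // addrK.
    by rewrite max_idealP ?invf_div // mulf_neq0 ?lin_neq0 ?invr_eq0.
  exists 1, 0%N, 1%N; split; first exact: oner_neq0.
  rewrite rmorph1 expr0 expr1 mulr1 mul1r eb /one_unit.
  rewrite (_ : _ - 1 = con (a - b) / lin a); last by rewrite mulrDl divff ?lin_neq0 // addrAC subrr add0r.
  by have [_ _] := not_vd hW h; rewrite invf_div.
(* By [none] the residue of (X - a)/c is that of some constant b; then X - (a + b c) has a larger
   value than X - a. *)
have improve a : exists a', max_ideal W (lin a' / lin a).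
  have [c [c0 Wy Wyi]] := tors a; have cc0 := con_neq0 c0.
  have [b Ub mb] : exists2 b, U b & max_ideal W (lin a / con c - con b).
    apply: contrapT => nb; apply: none; exists a, c; split=> // f1 g1.
    apply: mono_le_of_transcendental => //; split=> // b Ub mb.
    by apply: nb; exists b.
  exists (a + b * c); rewrite (linD _ a) opprD addNKr.
  rewrite (_ : _ / _ = (con c / lin a) * (lin a / con c - con b)); first exact: max_idealM.
  by rewrite rmorphN rmorphM /=; field; rewrite cc0 lin_neq0.
(* Induction on the list: if the value of X - a is at least that of X - b, an improvement of a
   serves; otherwise b does. *)
have close (rs : seq L) : exists b, forall a, a \in rs -> max_ideal W (lin b / lin a).
  elim: rs => [|a rs [b hb]]; first by exists 0.
  have [h|h] := pselect (W (lin a / lin b)).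
    have [a' ha'] := improve a; exists a' => x; rewrite inE => /orP[/eqP -> //|xs].
    rewrite (_ : _ / _ = (lin a' / lin a) * (lin a / lin b * (lin b / lin x))).
      by apply: max_idealMr => //; apply: vdM => //; case: (hb x xs).
    by field; rewrite !lin_neq0.
  have [_ _ mb] := not_vd hW h; exists b => x; rewrite inE => /orP[/eqP ->|]; last exact: hb.
  by rewrite -invf_div.
(* Here Z = 1: for b closer to X than all roots a, each X - a is the constant b - a up to a
   1-unit. *)
have [rs hrs] := monomial_mod_frac (oner_neq0 _) f0 g0.
have [b hb] := close rs.
apply: (not_monomial (oner_neq0 _) tr (hrs _)); last by left.
move=> a /hb mab.
have ba : b - a != 0.
  apply: contraPneq mab => /eqP; rewrite subr_eq0 => /eqP ->.
  by rewrite divff ?lin_neq0 //; exact: max_ideal1.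
exists (b - a), 0%N, 0%N; split=> //; rewrite !expr0 !mulr1.
rewrite -[_ / _]invrK; apply: one_unitV => //; rewrite invf_div /one_unit.
rewrite (_ : con (b - a) = lin a - lin b); last by rewrite (linD a b) addrAC subrr add0r.
rewrite (_ : _ - 1 = - (lin b / lin a)); first exact: max_idealN.
by rewrite mulrBl divff ?lin_neq0 // addrAC subrr add0r.
Qed.

End ResiduallyTranscendental.

(** * The bijection *)

Section Bijection.
Variables (K : fieldType) (L : closedFieldType) (iota : {rmorphism K -> L}).
Hypothesis Lalg : forall x : L, exists p : {poly K}, p != 0 /\ root (map_poly iota p) x.
Variables (V : K -> Prop) (U : L -> Prop).
Hypotheses (hV : is_valuation_domain V) (hU : is_valuation_domain U).
Hypothesis hUV : forall k : K, U (iota k) <-> V k.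

(** Transport by [s] leads to the pair (s alpha, s c), where [s c] may be replaced by [c] because it
    has the same value by [automorphism_value]. *)
Lemma Theta_orbit (alpha c alpha' c' : L) : c != 0 -> c' != 0 ->
  same_orbit iota U alpha c alpha' c' ->
  forall phi, Theta iota U alpha c phi <-> Theta iota U alpha' c' phi.
Proof.
move=> c0 c'0 [s [[_ sK sU] hb]] phi.
have sU' x : U (s x) <-> U x.
  split=> [/sU[y Uy /fmorph_inj <-] //|Ux].
  by apply/sU; exists x.
have [v1 v2] := automorphism_value Lalg hU c0 sK sU'.
have sc0 : s c != 0 by rewrite fmorph_eq0.
rewrite (Theta_transport _ _ hU hU c0 sK sU').
have hb1 : same_ball U (s alpha) (s c) (s alpha) c.
  by split=> //; rewrite subrr mul0r; exact: vd0.
have hb2 := ball_same_ball hU c0 c'0 hb.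
have [f [g [g0 ->]]] := fraction_ex phi.
have ig0 : map_poly iota g != 0 by rewrite map_poly_eq0.
rewrite !Theta_frac // (mono_le_same_ball hU _ sc0 c0 ig0 hb1).
exact: mono_le_same_ball.
Qed.

Lemma Theta_injective (alpha c alpha' c' : L) : c != 0 -> c' != 0 ->
  (forall phi, Theta iota U alpha c phi <-> Theta iota U alpha' c' phi) ->
  same_orbit iota U alpha c alpha' c'.
Proof.
move=> c0 c'0 hT.
have [s [sK sW]] := conjugate_over_KX Lalg (monoU_valuation_domain hU alpha c0)
  (monoU_valuation_domain hU alpha' c'0) hT.
have sU x : U (s x) <-> U x.
  have := sW x%:P 1; rewrite rmorph1 map_polyC rmorph1 !divr1 !monoU_const //.
  by move=> ->.
have sbij := embedding_bijective Lalg sK.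
exists s; split.
  split=> // y; split=> [Uy|[x Ux <-]]; last exact/sU.
  have [t st ts] := sbij; exists (t y) => //.
  by apply/sU; rewrite ts.
have sc0 : s c != 0 by rewrite fmorph_eq0.
have hb : same_ball U (s alpha) (s c) alpha' c'.
  apply: mono_le_inj => // f g g0; have [t st ts] := sbij.
  (* Every polynomial over L is an image under the bijective [s], so the comparison for (s alpha, s
     c) can be pulled back to (alpha, c). *)
  have lift (h : {poly L}) : exists h', h = map_poly s h'.
    exists (\poly_(i < size h) t h`_i); apply/polyP => i; rewrite coef_map coef_poly.
    by case: ltnP => [_|le] /=; [rewrite ts|rewrite rmorph0 nth_default].
  have [f' ef] := lift f; have [g' eg] := lift g; subst f g.
  have g'0 : g' != 0 by rewrite map_poly_eq0 in g0.
  rewrite (mono_le_transport _ _ _ _ sU) -monoU_frac // sW monoU_frac //.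
have [v1 v2] := automorphism_value Lalg hU c0 sK sU.
have hb1 : same_ball U (s alpha) c (s alpha) (s c).
  by split=> //; rewrite subrr mul0r; exact: vd0.
move=> x; rewrite (same_ball_ball hU _ _ hb1) //.
exact: same_ball_ball.
Qed.

Lemma Theta_surjective (W : {fraction {poly K}} -> Prop) :
  is_extension_KX V W -> residually_transcendental V W ->
  exists alpha c : L, c != 0 /\ (forall phi, W phi <-> Theta iota U alpha c phi).
Proof.
move=> [hW WV] [w0 Ww0 tr].
have [W' [hW' W'W]] := chevalley_extension (embedKX iota) hW.
pose con := fraction_const L.
pose U1 l := W' (con l).
have hU1 : is_valuation_domain U1 := vd_pullback con hW'.
have conK k : con (iota k) = embedKX iota (constKX k) by rewrite embedKX_poly map_polyC.
have hU1V k : U1 (iota k) <-> V k by rewrite /U1 conK W'W.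
have one0 : (1 : L) != 0 by exact: oner_neq0.
(* The Gauss valuations built on [U1] and [U], with alpha = 0 and c = 1, agree on K(X) since both
   come from [V]; on constants a conjugation between them carries [U1] to [U]. *)
have [s [sK sU]] : exists s : {rmorphism L -> L}, (forall k, s (iota k) = iota k) /\
    forall x, U (s x) <-> U1 x.
  have [|s [sK sW]] := conjugate_over_KX Lalg (monoU_valuation_domain hU1 0 one0)
      (monoU_valuation_domain hU 0 one0).
    move=> phi; have [f [g [g0 ->]]] := fraction_ex phi.
    rewrite embedKX_frac // !monoU_frac ?map_poly_eq0 // !mono_le_gauss.
    have e (h : {poly L}) : affine_subst 0 1 h = h.
      by rewrite /affine_subst scale1r addr0 comp_polyXr.
    by rewrite !e (gauss_le_pullback _ _ hU1V) (gauss_le_pullback _ _ hUV).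
  exists s; split=> // x.
  have := sW x%:P 1; rewrite rmorph1 map_polyC rmorph1 !divr1 !monoU_const //.
  by move=> ->.
have evX (h : {poly L}) : (map_poly con h).[('X)%:F] = h%:F.
  have -> : map_poly con h = map_poly (@FracField.tofrac {poly L}) (map_poly polyC h).
    by rewrite -map_poly_comp.
  by rewrite horner_map -/(comp_poly 'X h) comp_polyXr.
have trX (h : {poly L}) : h != 0 -> (map_poly con h).[('X)%:F] != 0.
  by rewrite evX tofrac_eq0.
have [fw [gw [gw0 ew]]] := fraction_ex (embedKX iota w0).
(* Such a b is a root of a primitive P over [V], and P(w) = R(w) (w - b) with R integral would lie
   in the maximal ideal, against the transcendence of the residue of w. *)
have hw0 b : U1 b -> ~ max_ideal W' (embedKX iota w0 - con b).
  move=> Ub mb; have [p [p0 /rootP pb]] := Lalg b.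
  have [a [P [a0 eP pP]]] := primitive_part hV p0.
  have [iP [i ni]] := pP; have [Pi0 VPi] := not_max_ideal hV ni.
  apply: (tr P iP); first by exists i.
  apply/(max_ideal_pullback hW hW' W'W).
  rewrite -horner_map /= -map_poly_comp.
  have -> : map_poly (embedKX iota \o @constKX K) P = map_poly con (map_poly iota P).
    by rewrite -map_poly_comp; apply: eq_map_poly => k /=; rewrite -conK.
  set Q := map_poly con _.
  have pQ : primitive_poly W' Q.
    split=> [k|]; first by rewrite !coef_map; exact/hU1V.
    have maxUW := @max_ideal_pullback _ _ con U1 W' hU1 hW' (fun x => iff_refl _).
    exists i; rewrite !coef_map => /maxUW/(max_ideal_pullback hV hU1 hU1V).
    exact: ni.
  have /factor_theorem[R eR] : root Q (con b).
    rewrite /Q fmorph_root; apply/rootP.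
    move/eqP: pb; rewrite eP map_polyZ hornerZ mulf_eq0 fmorph_eq0 (negPf a0).
    by move=> /eqP.
  rewrite eR hornerM hornerD hornerN hornerX hornerC; apply: max_idealM => //.
  have iR : vd_poly W' R by apply: (cofactor_XsubC_integral (a := con b)); rewrite -?eR.
  rewrite horner_coef; apply: vd_sum => // k _; apply: vdM => //; apply: vdX => //.
  exact/W'W.
have [alpha [c [c0 hac]]] : exists alpha c, c != 0 /\ forall f1 g1, g1 != 0 ->
    W' ((map_poly con f1).[('X)%:F] / (map_poly con g1).[('X)%:F]) <->
    mono_le U1 alpha c g1 f1.
  apply: (@residually_transcendental_mono_le _ _ con _ trX W' hW' fw gw).
    by rewrite !evX -ew; exact/W'W.
  by move=> b Ub; rewrite !evX -ew; exact: hw0.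
(* The parameters found over [U1] are carried to [U] by [s]. *)
exists (s alpha), (s c); split; first by rewrite fmorph_eq0.
move=> phi; rewrite -(Theta_transport _ _ hU1 hU c0 sK sU) -W'W.
have [f [g [g0 ->]]] := fraction_ex phi.
rewrite Theta_frac //= embedKX_frac // -hac ?map_poly_eq0 //.
by rewrite !evX.
Qed.

End Bijection.

Theorem mainTheorem2
  (K : fieldType) (L : closedFieldType) (iota : {rmorphism K -> L})
  (* L is an algebraic closure of K (via iota) *)
  (Lalg : forall x : L, exists p : {poly K}, p != 0 /\ root (map_poly iota p) x)
  (V : K -> Prop) (U : L -> Prop)
  (hV : is_valuation_domain V)
  (hU : is_valuation_domain U)
  (hUV : forall k : K, U (iota k) <-> V k) :
  (* Theta is well defined on orbits: the value depends only on the orbit *)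
  (forall alpha c alpha' c' : L, c != 0 -> c' != 0 ->
     same_orbit iota U alpha c alpha' c' ->
     forall phi, Theta iota U alpha c phi <-> Theta iota U alpha' c' phi)
  (* Theta takes values in W_rt *)
  /\ (forall alpha c : L, c != 0 ->
        is_extension_KX V (Theta iota U alpha c) /\
        residually_transcendental V (Theta iota U alpha c))
  (* Theta is injective on orbits *)
  /\ (forall alpha c alpha' c' : L, c != 0 -> c' != 0 ->
        (forall phi, Theta iota U alpha c phi <-> Theta iota U alpha' c' phi) ->
        same_orbit iota U alpha c alpha' c')
  (* Theta is surjective onto W_rt *)
  /\ (forall W : {fraction {poly K}} -> Prop,
        is_extension_KX V W -> residually_transcendental V W ->
        exists alpha c : L, c != 0 /\
          (forall phi, W phi <-> Theta iota U alpha c phi)).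
Proof.
split; first by move=> *; exact: Theta_orbit.
split; last split.
- move=> alpha c c0; split; last exact: Theta_residually_transcendental.
  split; first exact: Theta_valuation_domain.
  by move=> k; rewrite Theta_const.
- by move=> *; exact: Theta_injective.
by move=> W; exact: Theta_surjective.
Qed.
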